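(* Suppose $V$ is an irreducible representation of $H$, $n=\dim V$. For any subspace $W\subseteq V$ of dimension $k$ there exist a positive integer $m\le C(n,k)$ (with $C(n,k)$ depending only on $n,k$) and a Zariski open dense subset $\mathcal O_W\subseteq H^m$ such that for all $(h_1,\dots,h_m)\in\mathcal O_W$ and all subspaces $W'\subseteq V$, $$\dim\pi_{h_1.W}(W')+\cdots+\dim\pi_{h_m.W}(W')\ge\frac{mk}{n}\dim W'.$$ The integer $m$ and the set $\mathcal O_W$ do not depend on $W'$.
   Context: $\mathbf H$ is a connected semisimple $\mathbb R$-group and $H=\mathbf H(\mathbb R)$ with the Zariski topology coming from $\mathbf H$. $V$ is a finite-dimensional nontrivial representation of $H$ coming from a regular representation of $\mathbf H$, equipped with a fixed inner product; $\pi_W$ denotes orthogonal projection onto a subspace $W$. *)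

(* Defs.v *)
From mathcomp Require Import all_boot all_order all_algebra.
From mathcomp Require Import Rstruct.
From mathcomp Require Import mpoly complex.
Set Implicit Arguments. Unset Strict Implicit. Unset Printing Implicit Defensive.
Import Order.TTheory GRing.Theory Num.Theory.
Local Open Scope ring_scope.

Definition RR : rcfType := Rdefinitions.R.
Definition CC : numClosedFieldType := RR[i].
Definition toC (x : RR) : CC := real_complex RR x.

Definition coordsR N (g : 'M[RR]_N) : 'I_(N * N) -> RR := fun i => mxvec g 0 i.
Definition coordsC N (g : 'M[CC]_N) : 'I_(N * N) -> CC := fun i => mxvec g 0 i.
Definition coordsRm m N (h : 'I_m -> 'M[RR]_N) : 'I_(m * (N * N)) -> RR :=
  fun i => mxvec (\matrix_(j < m, l < N * N) mxvec (h j) 0 l) 0 i.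

Definition evalC n (p : {mpoly RR[n]}) (x : 'I_n -> CC) : CC :=
  (map_mpoly toC p).@[x].

Definition HC N (S : {mpoly RR[N * N]} -> Prop) : 'M[CC]_N -> Prop :=
  fun g => g \in unitmx /\ forall p, S p -> evalC p (coordsC g) = 0.
Definition HR N (S : {mpoly RR[N * N]} -> Prop) : 'M[RR]_N -> Prop :=
  fun g => g \in unitmx /\ forall p, S p -> p.@[coordsR g] = 0.

Definition is_subgroup N (A : 'M[CC]_N -> Prop) : Prop :=
  [/\ A 1%:M, (forall g h, A g -> A h -> A (g *m h))
    & (forall g, A g -> A (invmx g))].

Definition zclosed_in N (A B : 'M[CC]_N -> Prop) : Prop :=
  exists T : {mpoly CC[N * N]} -> Prop,
    forall g, B g <-> (A g /\ forall q, T q -> q.@[coordsC g] = 0).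

Definition zconnected N (A : 'M[CC]_N -> Prop) : Prop :=
  forall B1 B2, zclosed_in A B1 -> zclosed_in A B2 ->
    (forall g, A g -> B1 g \/ B2 g) -> (forall g, ~ (B1 g /\ B2 g)) ->
    (forall g, A g -> B1 g) \/ (forall g, A g -> B2 g).

Definition normal_in N (G A : 'M[CC]_N -> Prop) : Prop :=
  forall g a, G g -> A a -> A (invmx g *m a *m g).

Definition comm_subgroup N (A : 'M[CC]_N -> Prop) : 'M[CC]_N -> Prop :=
  fun x => forall B, is_subgroup B ->
    (forall a b, A a -> A b -> B (invmx a *m invmx b *m a *m b)) -> B x.
Definition derived N (k : nat) (A : 'M[CC]_N -> Prop) := iter k (@comm_subgroup N) A.
Definition solvable_grp N (A : 'M[CC]_N -> Prop) : Prop :=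
  exists k, forall x, derived k A x <-> x = 1%:M.

(* semisimple: the radical (largest connected solvable normal closed subgroup)
   is trivial, i.e. every such subgroup is trivial *)
Definition semisimple N (G : 'M[CC]_N -> Prop) : Prop :=
  forall A, is_subgroup A -> (forall a, A a -> G a) -> zclosed_in G A ->
    zconnected A -> normal_in G A -> solvable_grp A -> forall a, A a -> a = 1%:M.

Definition rhoC N n (k0 : nat) (P : 'I_n -> 'I_n -> {mpoly RR[N * N]})
  (g : 'M[CC]_N) : 'M[CC]_n :=
  \matrix_(i, j) (evalC (P i j) (coordsC g) * (\det g) ^- k0).
Definition rhoR N n (k0 : nat) (P : 'I_n -> 'I_n -> {mpoly RR[N * N]})
  (g : 'M[RR]_N) : 'M[RR]_n :=
  \matrix_(i, j) ((P i j).@[coordsR g] * (\det g) ^- k0).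

Definition regular_rep N n (S : {mpoly RR[N * N]} -> Prop) (k0 : nat)
  (P : 'I_n -> 'I_n -> {mpoly RR[N * N]}) : Prop :=
  rhoC k0 P 1%:M = 1%:M /\
  forall g h, HC S g -> HC S h -> rhoC k0 P (g *m h) = rhoC k0 P g *m rhoC k0 P h.

(* Vectors of V = R^n are row vectors; h acts by v |-> (rho h v^T)^T = v rho(h)^T.
   A subspace is the row space of a matrix. *)
Definition act N n (rho : 'M[RR]_N -> 'M[RR]_n) (h : 'M[RR]_N) (W : 'M[RR]_n)
  : 'M[RR]_n := W *m (rho h)^T.

Definition nontrivial_rep N n (H : 'M[RR]_N -> Prop) (rho : 'M[RR]_N -> 'M[RR]_n)
  : Prop := exists h, H h /\ rho h != 1%:M.

Definition irreducible_rep N n (H : 'M[RR]_N -> Prop) (rho : 'M[RR]_N -> 'M[RR]_n)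
  : Prop :=
  (0 < n)%N /\
  forall U : 'M[RR]_n, (forall h, H h -> (act rho h U <= U)%MS) ->
    (U == (0 : 'M[RR]_n))%MS \/ (U == (1%:M : 'M[RR]_n))%MS.

Definition inner_product n (Q : 'M[RR]_n) : Prop :=
  Q^T = Q /\ forall v : 'rV[RR]_n, v != 0 -> 0 < (v *m Q *m v^T) 0 0.

(* matrix (acting on row vectors on the right) of the Q-orthogonal projection
   onto the row space of U *)
Definition projmx n (Q U : 'M[RR]_n) : 'M[RR]_n :=
  let B := row_base U in Q *m B^T *m invmx (B *m Q *m B^T) *m B.

Definition dim_proj n (Q U W' : 'M[RR]_n) : nat := \rank (W' *m projmx Q U).

Definition in_Hm m N (S : {mpoly RR[N * N]} -> Prop) (h : 'I_m -> 'M[RR]_N) : Prop :=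
  forall j, HR S (h j).
Definition zero_set_m m N (T : {mpoly RR[m * (N * N)]} -> Prop)
  (h : 'I_m -> 'M[RR]_N) : Prop := forall q, T q -> q.@[coordsRm h] = 0.

Definition zopen_dense_Hm m N (S : {mpoly RR[N * N]} -> Prop)
  (O : ('I_m -> 'M[RR]_N) -> Prop) : Prop :=
  (exists T, forall h, O h <-> (in_Hm S h /\ ~ zero_set_m T h)) /\
  (forall T', (forall h, O h -> zero_set_m T' h) ->
     forall h, in_Hm S h -> zero_set_m T' h).

(* Main.v *)
Require Import Defs.
From mathcomp Require Import all_boot all_order all_algebra.
From mathcomp Require Import Rstruct.
From mathcomp Require Import mpoly complex.
From mathcomp Require Import perm ring zify.
From Stdlib Require Import Classical ClassicalEpsilon.
From Coquelicot Require Hierarchy Rbar Series PSeries ElemFct Lim_seq.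
Import Order.TTheory GRing.Theory Num.Theory.
Local Open Scope ring_scope.

Set Implicit Arguments.
Unset Strict Implicit.
Unset Printing Implicit Defensive.

(**
Write G for the complex group and H for its real points.

H is Zariski irreducible.  Call a polynomial f flat when t |-> f(exp(tX)) vanishes to
infinite order at 0 for every X in Lie(G).  Flat polynomials form a prime ideal; by
Krull's intersection theorem a flat polynomial vanishes near 1 on G, and since the ideals
of germs at the points of G are translates of each other, connectedness makes it vanish
on all of G.  As exp(tX) is in H for real X, a polynomial vanishing on H is flat.

Put rk_h(U) := rank of the pairing of U with h.W, so that the sum to be bounded is
sum_j rk_(h_j)(U), and let r(U) be the maximum of rk_h(U) over h.  Irreducibility of H makes
r submodular, so irreducibility of V gives n r(U) >= k dim U (the largest minimizer of
n r - k dim is invariant).  If equality holds, U has a complement with equality, and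
rk_h(V) = k forces rk_h(U) = r(U) for every h.  Otherwise n r(U) >= k dim U + 1, and a
bounded number of bad indices j is harmless once m is large.  The number of j with
rk_(h_j)(U) < r is bounded for a generic tuple: the r-minors of the pairing are linear
combinations of the degree r monomials in the entries of the representation, and generic
points separate such functions on H.  This needs finitely many determinants to be
nonzero, none of which involves U.
*)

(** * Noetherian rings *)

Definition is_ideal (R : comNzRingType) (I : R -> Prop) : Prop :=
  [/\ I 0, forall x y, I x -> I y -> I (x + y) & forall a x, I x -> I (a * x)].

Definition noetherian (R : comNzRingType) : Prop :=
  forall I : nat -> R -> Prop, (forall k, is_ideal (I k)) ->
    (forall k x, I k x -> I k.+1 x) ->
    exists K, forall k x, I k x -> I K x.

Lemma chain_le (R : Type) (I : nat -> R -> Prop) :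
  (forall k x, I k x -> I k.+1 x) -> forall j k x, (j <= k)%N -> I j x -> I k x.
Proof.
move=> inc j k x /subnK <-; elim: (k - j)%N => [|d IHd] //= Ij.
by rewrite addSn; apply/inc/IHd.
Qed.

Lemma noetherian_field (F : fieldType) : noetherian F.
Proof.
move=> I idl inc.
have [[k [x Ikx xn0]]|none] := classic (exists k, exists2 x, I k x & x != 0).
  exists k => j y _; have [_ _ mulI] := idl k.
  by rewrite -[y](mulfVK xn0); apply: mulI.
exists 0%N => k x Ikx; have [->|xn0] := eqVneq x 0; first by case: (idl 0%N).
by case: none; exists k, x.
Qed.

Lemma noetherian_surj (R R' : comNzRingType) (f : {rmorphism R -> R'}) :
  (forall y, exists x, f x = y) -> noetherian R -> noetherian R'.
Proof.
move=> surj noeR I idl inc.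
have [||K HK] := noeR (fun k x => I k (f x)).
- move=> k; have [I0 ID IM] := idl k; split=> [|x y Ix Iy|a x Ix].
  + by rewrite rmorph0.
  + by rewrite rmorphD; apply: ID.
  + by rewrite rmorphM; apply: IM.
- by move=> k x; apply: inc.
by exists K => k y; have [x <-] := surj y; apply: HK.
Qed.

(* The coefficients in degree [d] of the elements of degree at most [d] of [I k]
   form ideals increasing in both [k] and [d]; the diagonal chain and the finitely
   many chains with small [d] are stationary, which makes [I k] stationary. *)
Lemma noetherian_poly (R : comNzRingType) :
  noetherian R -> noetherian {poly R}.
Proof.
move=> noeR I idl inc.
pose L d k a := exists2 p : {poly R}, I k p & (size p <= d.+1)%N /\ p`_d = a.
have Lidl d k : is_ideal (L d k).
  have [I0 ID IM] := idl k; split.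
  - by exists 0 => //; rewrite size_poly0 coef0.
  - move=> _ _ [p Ip [sp <-]] [q Iq [sq <-]]; exists (p + q); first exact: ID.
    by rewrite coefD (leq_trans (size_polyD _ _)) // geq_max sp sq.
  - move=> a _ [p Ip [sp <-]]; exists (a%:P * p); first exact: IM.
    by rewrite coefCM mul_polyC (leq_trans (size_scale_leq _ _)).
have Linck d k a : L d k a -> L d k.+1 a.
  by move=> [p /inc Ip ?]; exists p.
have Lincd d k a : L d k a -> L d.+1 k a.
  have [I0 ID IM] := idl k.
  move=> [p Ip [sp <-]]; exists ('X * p); first exact: IM.
  by rewrite coefXM /= (leq_trans (size_polyMleq _ _)) // size_polyX.
have [D HD] : exists D, forall k a, L k k a -> L D D a.
  by apply: noeR => [k|k a Lk] //; apply/Lincd/Linck.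
have [E HE] : exists E, forall d k a, (d < D)%N -> L d k a -> L d E a.
  elim: {1}D => [|D' [E HE]]; first by exists 0%N.
  have [E' HE'] : exists E', forall k a, L D' k a -> L D' E' a.
    by apply: noeR => [k|k a] //; apply: Linck.
  exists (maxn E E') => d k a; rewrite ltnS leq_eqVlt => /predU1P[->|lt_d] Ld.
    by apply: (chain_le (Linck D')) (leq_maxr E E') _; apply: HE' Ld.
  by apply: (chain_le (Linck d)) (leq_maxl E E') _; apply: HE Ld.
have stat d k a : L d k a -> L d (maxn D E) a.
  move=> Ld; have [lt_d|le_d] := ltnP d D.
    by apply: (chain_le (Linck d)) (leq_maxr D E) _; apply: HE Ld.
  apply: (chain_le (Linck d)) (leq_maxl D E) _.
  have LD : L (maxn d k) (maxn d k) a.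
    have := chain_le (Linck d) (leq_maxr d k) Ld.
    by apply: (chain_le (fun i => @Lincd i (maxn d k))); apply: leq_maxl.
  by apply: (chain_le (fun i => @Lincd i D)) le_d _; apply: HD LD.
exists (maxn D E) => k p; have [I0 ID IM] := idl (maxn D E).
have [n] := ubnP (size p); elim: n k p => // n IHn k p; rewrite ltnS => sp Ip.
have [->//|pn0] := eqVneq p 0.
have sp0 : (0 < size p)%N by rewrite lt0n size_poly_eq0.
have [q Iq [sq eq_q]] : L (size p).-1 (maxn D E) (lead_coef p).
  by apply: (stat _ k); exists p => //; split=> //; rewrite prednK.
rewrite prednK // in sq.
rewrite -[p](subrK q); apply: ID => //; apply: (IHn (maxn k (maxn D E))).
  apply: leq_trans sp; rewrite -(ltn_predK sp0) ltnS; apply/leq_sizeP => j.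
  rewrite leq_eqVlt => /predU1P[<-|].
    by rewrite coefB eq_q lead_coefE subrr.
  rewrite prednK // => le_j.
  by rewrite coefB !nth_default ?subrr // (leq_trans sq).
have [J0 JD JM] := idl (maxn k (maxn D E)).
rewrite -[- q]mulN1r; apply: JD; first exact: (chain_le inc (leq_maxl _ _)).
by apply: JM; apply: (chain_le inc (leq_maxr _ _)).
Qed.

(** Hilbert's basis theorem applies to iterated univariate polynomials by induction on n. A morphism
    from [iter_poly_eval] then carries it over to [{mpoly R[n]}]. *)
Fixpoint iter_poly (R : comNzRingType) (n : nat) : comNzRingType :=
  if n is n'.+1 then {poly iter_poly R n'} : comNzRingType else R.

Lemma noetherian_iter_poly (R : comNzRingType) n :
  noetherian R -> noetherian (iter_poly R n).
Proof. by move=> noeR; elim: n => //= n; apply: noetherian_poly. Qed.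

Lemma iter_poly_eval (R R' : comNzRingType) (f : {rmorphism R -> R'}) n
    (v : nat -> R') :
  exists2 e : {rmorphism iter_poly R n -> R'},
    forall a, exists x, e x = f a &
    forall i, (i < n)%N -> exists x, e x = v i.
Proof.
elim: n => [|n [e eC eX]]; first by exists f => // a; exists a.
exists (horner_morph (fun x => mulrC (v n) (e x)) :
    {rmorphism {poly iter_poly R n} -> R'}) => [a|i].
  by have [x <-] := eC a; exists x%:P; apply: horner_morphC.
rewrite ltnS leq_eqVlt => /predU1P[->|/eX[x <-]].
  by exists 'X; apply: horner_morphX.
by exists x%:P; apply: horner_morphC.
Qed.

(** * Multivariate polynomials *)

(** Induction along ring generators, suited to identities between ring morphisms or derivations:
    only constants and variables need a computation. *)
Lemma mpoly_ind_ring (R : comNzRingType) n (Pr : {mpoly R[n]} -> Prop) :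
  (forall c, Pr c%:MP) -> (forall i, Pr 'X_i) ->
  (forall p q, Pr p -> Pr q -> Pr (p + q)) ->
  (forall p q, Pr p -> Pr q -> Pr (p * q)) -> forall p, Pr p.
Proof.
move=> PC PX PD PM; have P1 : Pr 1 by rewrite -mpolyC1.
have PXn i k : Pr ('X_i ^+ k).
  by elim: k => // k IHk; rewrite exprS; apply: PM.
apply: mpolyind => [|c m p _ _ Pp]; first by rewrite -mpolyC0; apply: PC.
apply: (PD) => //; rewrite -mul_mpolyC; apply: (PM) => //.
rewrite mpolyXE_id; apply: (@big_ind _ Pr 1 *%R P1 PM) => i _; apply: PXn.
Qed.

Lemma noetherian_mpoly (R : comNzRingType) n :
  noetherian R -> noetherian {mpoly R[n]}.
Proof.
move=> noeR.
have [e eC eX] := iter_poly_eval (@mpolyC n R)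
  n (fun i => if (insub i : option 'I_n) is Some j then 'X_j else 0).
apply: (noetherian_surj (f := e)); last exact: noetherian_iter_poly.
apply: mpoly_ind_ring => [c|i|p q [x px] [y qy]|p q [x px] [y qy]].
- exact: eC.
- by have := eX i (ltn_ord i); rewrite valK.
- by exists (x + y); rewrite rmorphD px qy.
- by exists (x * y); rewrite rmorphM px qy.
Qed.

Lemma poly_nonroot (F : numFieldType) (q : {poly F}) :
  q != 0 -> exists k : nat, q.[k%:R] != 0.
Proof.
move=> qn0; pose rs := [seq k%:R : F | k <- iota 0 (size q)].
apply: NNPP => none; have := @max_poly_roots F q rs qn0.
rewrite size_map size_iota ltnn => /(_ _ _)/negP; apply; first 1 last.
- by rewrite map_inj_uniq ?iota_uniq // => a b /eqP; rewrite eqr_nat => /eqP.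
- by [].
apply/allP => _ /mapP[k _ ->]; apply: contraT => kn0.
by case: none; exists k.
Qed.

Lemma multinom_gt0 n (m : 'X_{1..n}) : m != 0%MM -> [exists i, (0 < m i)%N].
Proof.
move=> mn0; apply: contraNT mn0; rewrite negb_exists => /forallP m0.
by apply/eqP/mnmP => i; rewrite mnm0E; apply/eqP; rewrite -leqn0 leqNgt m0.
Qed.

(** Restriction to lines shows that the partial derivatives of a vanishing polynomial vanish too. In
    characteristic 0 every coefficient of positive degree is then recovered from a derivative, by
    induction on the degree, and the constant term is the value at 0. *)
Lemma mpoly_eq0 (F : numFieldType) n (p : {mpoly F[n]}) :
  (forall v, p.@[v] = 0) -> p = 0.
Proof.
have deriv_van (q : {mpoly F[n]}) i :
    (forall v, q.@[v] = 0) -> forall v, (mderiv i q).@[v] = 0.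
  move=> q0 v.
  pose line (r : {mpoly F[n]}) : {poly F} :=
    mmap (@polyC F) (fun j => (v j)%:P + (if j == i then 'X else 0)) r.
  have lineE (r : {mpoly F[n]}) t :
      (line r).[t] = r.@[fun j => v j + (if j == i then t else 0)].
    elim/mpoly_ind_ring: r => [c|j|r s IHr IHs|r s IHr IHs].
    - by rewrite /line mmapC mevalC hornerC.
    - rewrite /line mmapX mmap1U mevalXU hornerD hornerC.
      by case: ifP => _; rewrite ?hornerX ?horner0.
    - by rewrite /line rmorphD /= mevalD hornerD -IHr -IHs.
    - by rewrite /line rmorphM /= mevalM hornerM -IHr -IHs.
  have line_deriv (r : {mpoly F[n]}) : (line r)^`() = line (mderiv i r).
    elim/mpoly_ind_ring: r => [c|j|r s IHr IHs|r s IHr IHs].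
    - by rewrite mderivC /line mmapC mmap0 derivC.
    - rewrite /line mmapX mmap1U mderivX mmapZ mmapX derivD derivC add0r mnm1E.
      have [->|ne] := eqVneq j i; last by rewrite mul0r derivC.
      have -> : (U_(i) - U_(i) = 0)%MM by apply/mnmP => l; rewrite mnmBE subnn mnm0E.
      by rewrite mmap11 mulr1 derivX.
    - by rewrite mderivD /line !rmorphD /= derivD -/(line r) -/(line s) IHr IHs.
    - rewrite mderivM /line !(rmorphD, rmorphM) /= derivM.
      by rewrite -/(line r) -/(line s) IHr IHs.
  have : line q = 0.
    apply/eqP; apply: contraT => /poly_nonroot[k].
    by rewrite lineE q0 eqxx.
  move/(congr1 (fun r => r^`().[0])); rewrite line_deriv lineE deriv0 horner0.
  by move=> <-; apply: meval_eq => j; case: ifP; rewrite addr0.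
move=> p0; apply/mpolyP => m; rewrite mcoeff0.
have [d] := ubnP (mdeg m); elim: d m p p0 => // d IHd m p p0; rewrite ltnS => lt_m.
have [->|mn0] := eqVneq m 0%MM.
  rewrite -(p0 (fun=> 0)); elim/mpolyind: (p) => [|c m' q _ _ IHq].
    by rewrite mcoeff0 meval0.
  rewrite mcoeffD mevalD IHq mcoeffZ mevalZ mcoeffX mevalX; congr (c * _ + _).
  have [->|m'n0] := eqVneq m' 0%MM.
    by rewrite big1 // => i _; rewrite mnm0E.
  have /existsP[i m'i] := multinom_gt0 m'n0.
  by rewrite (bigD1 i) //= expr0n eqn0Ngt m'i mul0r.
have /existsP[i mi] := multinom_gt0 mn0.
have le_im : (U_(i) <= m)%MM by rewrite lep1mP -lt0n.
have lt_d : (mdeg (m - U_(i)) < d)%N.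
  by move: lt_m; rewrite -{1}(submK le_im) mdegD mdeg1 addn1.
have := mcoeff_mderiv i p (m - U_(i)).
rewrite (IHd _ _ (deriv_van p i p0) lt_d) submK // => /esym/eqP.
by rewrite mulrn_eq0 => /eqP.
Qed.

(** * Left-invariant derivations and translations *)

Lemma iter_derivationM (R : comNzRingType) (D : R -> R) :
  {morph D : x y / x + y} -> (forall x y, D (x * y) = D x * y + x * D y) ->
  forall k x y, iter k D (x * y) =
    \sum_(i < k.+1) (iter i D x * iter (k - i) D y) *+ 'C(k, i).
Proof.
move=> DD DM k x y.
have D0 : D 0 = 0 by apply: (addrI (D 0)); rewrite -DD !addr0.
have DMn z n : D (z *+ n) = D z *+ n.
  by elim: n => [|n IHn]; rewrite ?mulr0n // !mulrS DD IHn.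
have Dsum (n : nat) (F : 'I_n -> R) : D (\sum_(i < n) F i) = \sum_(i < n) D (F i).
  exact: (big_morph D DD D0).
elim: k => [|k IHk]; first by rewrite big_ord_recl big_ord0 /= addr0.
rewrite iterS IHk Dsum.
under eq_bigr => i _ do rewrite DMn DM mulrnDl -!iterS.
rewrite big_split /= [in RHS]big_ord_recl /= bin0 mulr1n.
under [in RHS]eq_bigr => i _ do
  rewrite /bump /= add1n subSS binS mulrnDr.
rewrite [in RHS]big_split /= [LHS]addrC [RHS]addrA.
congr (_ + _).
rewrite big_ord_recl [in RHS]big_ord_recr /= bin0 mulr1n subn0.
rewrite (@bin_small k k.+1) // mulr0n addr0; congr (_ + _).
by apply: eq_bigr => i _; rewrite /bump /= add1n -[in RHS](subnSK (ltn_ord i)).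
Qed.

Section LeftInvariant.

Variables (K : comNzRingType) (N : nat).
Local Notation A := {mpoly K[N * N]}.
Implicit Types (X g : 'M[K]_N) (f : A).

Definition coords g : 'I_(N * N) -> K := fun l => mxvec g 0 l.

Definition xmx : 'M[A]_N := \matrix_(i, j) 'X_(mxvec_index i j).

Definition cmx g : 'M[A]_N := map_mx (@mpolyC _ K) g.

(** The left-invariant vector field of [X]: its components at g are the entries of [g *m X], so it
    is the derivative of f(g exp(tX)) at t = 0. *)
Definition lderiv X f : A := \sum_l mxvec (xmx *m cmx X) 0 l * mderiv l f.

Definition ltrans g f : A :=
  mmap (@mpolyC _ K) (fun l => mxvec (cmx g *m xmx) 0 l) f.

Lemma mxvec_xmx l : mxvec xmx 0 l = 'X_l.
Proof. by case/mxvec_indexP: l => i j; rewrite mxvecE mxE. Qed.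

Lemma eval_xmx g : map_mx (meval (coords g)) xmx = g.
Proof. by apply/matrixP => i j; rewrite !mxE mevalXU /coords mxvecE. Qed.

Lemma eval_cmx g v : map_mx (meval v) (cmx g) = g.
Proof. by apply/matrixP => i j; rewrite !mxE mevalC. Qed.

Lemma mxvec_map (R R' : Type) (h : R -> R') (M : 'M[R]_N) l :
  mxvec (map_mx h M) 0 l = h (mxvec M 0 l).
Proof. by rewrite -map_mxvec mxE. Qed.

Lemma lderivX X l : lderiv X 'X_l = mxvec (xmx *m cmx X) 0 l.
Proof.
rewrite /lderiv (bigD1 l) //= big1 ?addr0 => [|i ne].
  rewrite mderivX mnm1E eqxx scale1r.
  have -> : (U_(l) - U_(l) = 0)%MM by apply/mnmP => i; rewrite mnmBE subnn mnm0E.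
  by rewrite mpolyX0 mulr1.
by rewrite mderivX mnm1E eq_sym (negPf ne) scale0r mulr0.
Qed.

Lemma lderivC X c : lderiv X c%:MP = 0.
Proof. by rewrite /lderiv big1 // => l _; rewrite mderivC mulr0. Qed.

Lemma lderivD X : {morph lderiv X : p q / p + q}.
Proof.
by move=> p q; rewrite /lderiv -big_split; apply: eq_bigr => l _; rewrite mderivD mulrDr.
Qed.

Lemma lderivM X p q : lderiv X (p * q) = lderiv X p * q + p * lderiv X q.
Proof.
rewrite /lderiv mulr_suml mulr_sumr -big_split; apply: eq_bigr => l _ /=.
by rewrite mderivM; ring.
Qed.

Lemma lderiv_sum X (I : finType) (F : I -> A) :
  lderiv X (\sum_i F i) = \sum_i lderiv X (F i).
Proof.
apply: (big_morph _ (lderivD X)).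
by rewrite -mpolyC0 lderivC.
Qed.

Lemma iter_lderiv_sum X k (I : finType) (F : I -> A) :
  iter k (lderiv X) (\sum_i F i) = \sum_i iter k (lderiv X) (F i).
Proof. by elim: k => //= k ->; rewrite lderiv_sum. Qed.

Lemma iter_lderivD X k : {morph iter k (lderiv X) : p q / p + q}.
Proof. by move=> p q; elim: k => //= k ->; rewrite lderivD. Qed.

Lemma iter_lderivC X k c : (0 < k)%N -> iter k (lderiv X) c%:MP = 0.
Proof.
by case: k => // k _; rewrite iterSr lderivC; elim: k => //= k ->; rewrite -mpolyC0 lderivC.
Qed.

Lemma iter_lderivM X k p q : iter k (lderiv X) (p * q) =
  \sum_(i < k.+1) (iter i (lderiv X) p * iter (k - i) (lderiv X) q) *+ 'C(k, i).
Proof. exact/iter_derivationM/lderivM/lderivD. Qed.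

Lemma lderiv_line X Y (s : K) f :
  lderiv (X + s *: Y) f = lderiv X f + s%:MP * lderiv Y f.
Proof.
rewrite /lderiv mulr_sumr -big_split; apply: eq_bigr => l _ /=.
rewrite mulrA -mulrDl; congr (_ * _).
have -> : cmx (X + s *: Y) = cmx X + s%:MP *: cmx Y.
  by rewrite /cmx map_mxD map_mxZ.
by rewrite mulmxDr -scalemxAr linearD linearZ !mxE.
Qed.

Lemma ltransX g l : ltrans g 'X_l = mxvec (cmx g *m xmx) 0 l.
Proof. by rewrite /ltrans mmapX mmap1U. Qed.

Lemma ltransC g c : ltrans g c%:MP = c%:MP.
Proof. by rewrite /ltrans mmapC. Qed.

Lemma ltransD g : {morph ltrans g : p q / p + q}.
Proof. by move=> p q; rewrite /ltrans rmorphD. Qed.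

Lemma ltransM g : {morph ltrans g : p q / p * q}.
Proof. by move=> p q; rewrite /ltrans rmorphM. Qed.

Lemma ltrans_mx g (M : 'M[A]_N) l :
  ltrans g (mxvec M 0 l) = mxvec (map_mx (ltrans g) M) 0 l.
Proof. by rewrite mxvec_map. Qed.

Lemma ltrans_xmx g : map_mx (ltrans g) xmx = cmx g *m xmx.
Proof.
by apply/matrixP => i j; rewrite 2!mxE ltransX mxvecE.
Qed.

Lemma ltrans_mulmx g (M M' : 'M[A]_N) :
  map_mx (ltrans g) (M *m M') = map_mx (ltrans g) M *m map_mx (ltrans g) M'.
Proof. by rewrite /ltrans; exact: (map_mxM (mmap (@mpolyC _ K) _)). Qed.

Lemma ltrans_cmx g X : map_mx (ltrans g) (cmx X) = cmx X.
Proof. by apply/matrixP => i j; rewrite !mxE ltransC. Qed.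

Lemma ltrans_eval g f x : (ltrans g f).@[coords x] = f.@[coords (g *m x)].
Proof.
elim/mpoly_ind_ring: f => [c|l|p q IHp IHq|p q IHp IHq].
- by rewrite ltransC !mevalC.
- by rewrite ltransX mevalXU -mxvec_map map_mxM eval_xmx eval_cmx.
- by rewrite ltransD !mevalD IHp IHq.
- by rewrite ltransM !mevalM IHp IHq.
Qed.

Lemma ltransA g h f : ltrans g (ltrans h f) = ltrans (h *m g) f.
Proof.
elim/mpoly_ind_ring: f => [c|l|p q IHp IHq|p q IHp IHq].
- by rewrite !ltransC.
- by rewrite !ltransX ltrans_mx ltrans_mulmx ltrans_cmx ltrans_xmx mulmxA -map_mxM.
- by rewrite !ltransD IHp IHq.
- by rewrite !ltransM IHp IHq.
Qed.

Lemma ltrans1 f : ltrans 1%:M f = f.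
Proof.
elim/mpoly_ind_ring: f => [c|l|p q IHp IHq|p q IHp IHq].
- by rewrite !ltransC.
- by rewrite ltransX /cmx map_mx1 mul1mx mxvec_xmx.
- by rewrite ltransD IHp IHq.
- by rewrite ltransM IHp IHq.
Qed.

(** Left multiplication by [g] commutes with right multiplication by [X], which defines the vector
    field; the check on variables is the associativity of the matrix product. *)
Lemma lderiv_ltrans X g f : lderiv X (ltrans g f) = ltrans g (lderiv X f).
Proof.
elim/mpoly_ind_ring: f => [c|l|p q IHp IHq|p q IHp IHq].
- by rewrite ltransC lderivC -mpolyC0 ltransC.
- rewrite lderivX ltrans_mx ltrans_mulmx ltrans_cmx ltrans_xmx ltransX.
  case/mxvec_indexP: l => i j; rewrite !mxvecE !mxE lderiv_sum.
  under [RHS]eq_bigr => k _ do rewrite mxE mulr_suml.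
  rewrite [in RHS]exchange_big; apply: eq_bigr => k _ /=.
  rewrite [xmx k j]mxE [cmx g i k]mxE lderivM lderivC mul0r add0r lderivX.
  by rewrite mxvecE mxE mulr_sumr; apply: eq_bigr => m _; rewrite mulrA.
- by rewrite ltransD !lderivD IHp IHq ltransD.
- by rewrite ltransM !lderivM IHp IHq ltransD !ltransM.
Qed.

Lemma lderiv_xmx X (k : nat) l :
  iter k (lderiv X) 'X_l = mxvec (xmx *m cmx (iter k (mulmx X) 1%:M)) 0 l.
Proof.
elim: k => [|k IHk]; first by rewrite /= /cmx map_mx1 mulmx1 mxvec_xmx.
rewrite iterS IHk {IHk}; case/mxvec_indexP: l => i j.
rewrite !mxvecE mxE lderiv_sum iterS /cmx map_mxM mulmxA [RHS]mxE.
apply: eq_bigr => m _; rewrite lderivM [cmx _ m j]mxE lderivC mulr0 addr0.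
by rewrite [xmx i m]mxE lderivX mxvecE.
Qed.

End LeftInvariant.

Lemma map_lderiv (K K' : comNzRingType) (phi : {rmorphism K -> K'}) N
    (X : 'M[K]_N) f :
  map_mpoly phi (lderiv X f) = lderiv (map_mx phi X) (map_mpoly phi f).
Proof.
elim/mpoly_ind_ring: f => [c|l|p q IHp IHq|p q IHp IHq].
- by rewrite lderivC rmorph0 map_mpolyC lderivC.
- rewrite map_mpolyX !lderivX; case/mxvec_indexP: l => i j.
  rewrite !mxvecE !mxE rmorph_sum; apply: eq_bigr => k _.
  by rewrite rmorphM !mxE /= map_mpolyX map_mpolyC.
- by rewrite lderivD !rmorphD /= lderivD IHp IHq.
- by rewrite lderivM rmorphD !rmorphM /= lderivM IHp IHq.
Qed.

Lemma map_iter_lderiv (K K' : comNzRingType) (phi : {rmorphism K -> K'}) N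
    (X : 'M[K]_N) k f :
  map_mpoly phi (iter k (lderiv X) f) =
  iter k (lderiv (map_mx phi X)) (map_mpoly phi f).
Proof. by elim: k => //= k <-; rewrite map_lderiv. Qed.

Lemma meval_map (K K' : comNzRingType) (phi : {rmorphism K -> K'}) N
    (f : {mpoly K[N * N]}) g :
  (map_mpoly phi f).@[coords (map_mx phi g)] = phi f.@[coords g].
Proof.
elim/mpoly_ind_ring: f => [c|l|p q IHp IHq|p q IHp IHq].
- by rewrite map_mpolyC !mevalC.
- by rewrite map_mpolyX !mevalXU /coords mxvec_map.
- by rewrite !rmorphD /= IHp IHq.
- by rewrite !rmorphM /= IHp IHq.
Qed.

(** * Powers of the maximal ideal at the identity *)

Section PowersAtOne.

Variables (K : numFieldType) (N : nat).
Local Notation A := {mpoly K[N * N]}.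
Implicit Types (X : 'M[K]_N) (f g : A).

Definition ev1 f : K := f.@[coords 1%:M].

(** The k-th derivative of f(exp(tX)) at t = 0, without the factor 1/k!. *)
Definition taylor X k f : K := ev1 (iter k (lderiv X) f).

Definition uvar (l : 'I_(N * N)) : A := 'X_l - (coords 1%:M l)%:MP.

(** The k-th power of the maximal ideal m at the identity, which the [uvar l] generate. *)
Fixpoint mpow k g : Prop :=
  if k is k'.+1 then
    exists2 h : 'I_(N * N) -> A, forall l, mpow k' (h l) & g = \sum_l h l * uvar l
  else True.

Lemma ev1D f g : ev1 (f + g) = ev1 f + ev1 g. Proof. exact: mevalD. Qed.
Lemma ev1B f g : ev1 (f - g) = ev1 f - ev1 g. Proof. exact: mevalB. Qed.
Lemma ev1M f g : ev1 (f * g) = ev1 f * ev1 g. Proof. exact: mevalM. Qed.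
Lemma ev1C c : ev1 c%:MP = c. Proof. exact: mevalC. Qed.
Lemma ev1u l : ev1 (uvar l) = 0.
Proof. by rewrite ev1B ev1C /ev1 mevalXU subrr. Qed.
Lemma ev1_sum (I : finType) (F : I -> A) : ev1 (\sum_i F i) = \sum_i ev1 (F i).
Proof. exact: raddf_sum. Qed.

Lemma mpow_zero k : mpow k 0.
Proof.
elim: k => //= k IHk; exists (fun=> 0) => //.
by rewrite big1 // => l _; rewrite mul0r.
Qed.

Lemma mpowD k f g : mpow k f -> mpow k g -> mpow k (f + g).
Proof.
elim: k f g => //= k IHk f g [h Hh ->] [h' Hh' ->].
exists (fun l => h l + h' l) => [l|]; first exact: IHk.
by rewrite -big_split; apply: eq_bigr => l _; rewrite mulrDl.
Qed.

Lemma mpowM k a f : mpow k f -> mpow k (a * f).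
Proof.
elim: k f => //= k IHk f [h Hh ->].
exists (fun l => a * h l) => [l|]; first exact: IHk.
by rewrite mulr_sumr; apply: eq_bigr => l _; rewrite mulrA.
Qed.

Lemma mpowN k f : mpow k f -> mpow k (- f).
Proof. by rewrite -mulN1r; apply: mpowM. Qed.

Lemma mpow_sum k (I : finType) (F : I -> A) :
  (forall i, mpow k (F i)) -> mpow k (\sum_i F i).
Proof.
move=> HF; apply: (@big_ind _ (mpow k)) => [|x y|i _] //.
- exact: mpow_zero.
- exact: mpowD.
Qed.

Lemma mpow_u k l f : mpow k f -> mpow k.+1 (f * uvar l).
Proof.
move=> Hf; exists (fun j => if j == l then f else 0) => [j|].
  by case: ifP => // _; apply: mpow_zero.
rewrite (bigD1 l) //= eqxx big1 ?addr0 // => j /negPf->.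
by rewrite mul0r.
Qed.

Lemma mpow_mul j k f g : mpow j f -> mpow k g -> mpow (j + k) (f * g).
Proof.
elim: k g => [|k IHk] g; first by rewrite addn0 mulrC => Hf _; apply: mpowM.
move=> Hf [h Hh ->]; rewrite addnS mulr_sumr; apply: mpow_sum => l.
by rewrite mulrA; apply: mpow_u; apply: IHk => //; apply: Hh.
Qed.

Lemma mpow_ev1 f : mpow 1 (f - (ev1 f)%:MP).
Proof.
elim/mpoly_ind_ring: f => [c|l|p q IHp IHq|p q IHp IHq].
- by rewrite ev1C subrr; apply: mpow_zero.
- rewrite -[_ - _]mul1r; have -> : ev1 'X_l = coords 1%:M l by rewrite /ev1 mevalXU.
  exact: (@mpow_u 0).
- rewrite ev1D mpolyCD opprD addrACA; exact: mpowD IHp IHq.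
- rewrite ev1M mpolyCM.
  have -> : p * q - (ev1 p)%:MP * (ev1 q)%:MP =
    q * (p - (ev1 p)%:MP) + (ev1 p)%:MP * (q - (ev1 q)%:MP) by ring.
  exact: mpowD (mpowM _ IHp) (mpowM _ IHq).
Qed.

(** First-order expansion at the identity. For a product, the error not controlled by induction is
    (p - p(1)) (q - q(1)), a product of two elements of m. *)
Lemma mpow_linear f :
  mpow 2 (f - (ev1 f)%:MP - \sum_l (ev1 (mderiv l f))%:MP * uvar l).
Proof.
elim/mpoly_ind_ring: f => [c|l|p q IHp IHq|p q IHp IHq].
- rewrite ev1C subrr sub0r big1 => [|l _]; first by apply: mpowN; apply: mpow_zero.
  by rewrite mderivC /ev1 meval0 mpolyC0 mul0r.
- rewrite (bigD1 l) //= big1 => [|j /negPf ne].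
    rewrite mderivX mnm1E eqxx scale1r.
    have -> : (U_(l) - U_(l) = 0)%MM by apply/mnmP => i; rewrite mnmBE subnn mnm0E.
    rewrite mpolyX0 /ev1 meval1 mevalXU addr0 mpolyC1 mul1r subrr.
    exact: (mpow_zero 2).
  by rewrite mderivX mnm1E eq_sym ne scale0r /ev1 meval0 mpolyC0 mul0r.
- have -> : \sum_l (ev1 (mderiv l (p + q)))%:MP * uvar l =
     \sum_l (ev1 (mderiv l p))%:MP * uvar l + \sum_l (ev1 (mderiv l q))%:MP * uvar l.
    rewrite -big_split; apply: eq_bigr => l _ /=.
    by rewrite mderivD ev1D mpolyCD mulrDl.
  move: IHp IHq; rewrite ev1D mpolyCD; set sp := \sum_l _; set sq := \sum_l _.
  move=> IHp IHq; have -> : p + q - ((ev1 p)%:MP + (ev1 q)%:MP) - (sp + sq) =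
    (p - (ev1 p)%:MP - sp) + (q - (ev1 q)%:MP - sq) by ring.
  exact: mpowD IHp IHq.
- have -> : \sum_l (ev1 (mderiv l (p * q)))%:MP * uvar l =
     (ev1 q)%:MP * (\sum_l (ev1 (mderiv l p))%:MP * uvar l) +
     (ev1 p)%:MP * (\sum_l (ev1 (mderiv l q))%:MP * uvar l).
    rewrite !mulr_sumr -big_split; apply: eq_bigr => l _ /=.
    by rewrite mderivM ev1D !ev1M mpolyCD !mpolyCM; ring.
  rewrite ev1M mpolyCM.
  move: IHp IHq; set sp := \sum_l _; set sq := \sum_l _ => IHp IHq.
  have -> : p * q - (ev1 p)%:MP * (ev1 q)%:MP
      - ((ev1 q)%:MP * sp + (ev1 p)%:MP * sq) =
    (ev1 q)%:MP * (p - (ev1 p)%:MP - sp) + (ev1 p)%:MP * (q - (ev1 q)%:MP - sq)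
    + (p - (ev1 p)%:MP) * (q - (ev1 q)%:MP) by ring.
  apply: mpowD; first exact: mpowD (mpowM _ IHp) (mpowM _ IHq).
  exact: (mpow_mul (mpow_ev1 p) (mpow_ev1 q)).
Qed.

(** Homogeneous forms of degree k; the recursion mirrors that of [mpow], so that the two can be
    matched by induction. *)
Fixpoint is_form k (F : A) : Prop :=
  if k is k'.+1 then
    exists2 H : 'I_(N * N) -> A, forall l, is_form k' (H l) & F = \sum_l H l * 'X_l
  else exists c, F = c%:MP.

Definition msubst (v : 'I_(N * N) -> A) (F : A) : A := mmap (@mpolyC _ K) v F.

Lemma msubst_sumX v (H : 'I_(N * N) -> A) :
  msubst v (\sum_l H l * 'X_l) = \sum_l msubst v (H l) * v l.
Proof.
rewrite /msubst rmorph_sum; apply: eq_bigr => l _.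
by rewrite rmorphM /= mmapX mmap1U.
Qed.

Lemma msubst_eval v F x : (msubst v F).@[x] = F.@[fun l => (v l).@[x]].
Proof.
elim/mpoly_ind_ring: F => [c|l|p q IHp IHq|p q IHp IHq].
- by rewrite /msubst mmapC !mevalC.
- by rewrite /msubst mmapX mmap1U mevalXU.
- by rewrite /msubst rmorphD !mevalD IHp IHq.
- by rewrite /msubst rmorphM !mevalM IHp IHq.
Qed.

Lemma mpow_msubst v k F :
  (forall l, mpow 1 (v l)) -> is_form k F -> mpow k (msubst v F).
Proof.
move=> Hv; elim: k F => // k IHk F [H HH ->]; rewrite msubst_sumX.
apply: mpow_sum => l; rewrite -addn1; apply: mpow_mul; last exact: Hv.
by apply: IHk; apply: HH.
Qed.

Lemma mpow1_u l : mpow 1 (uvar l).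
Proof. by rewrite -[uvar l]mul1r; apply: (@mpow_u 0). Qed.

(** Forms of degree k map onto the quotient of m^k by m^(k+1). *)
Lemma leading_form k g :
  mpow k g -> exists2 F, is_form k F & mpow k.+1 (g - msubst uvar F).
Proof.
elim: k g => [|k IHk] g.
  move=> _; exists (ev1 g)%:MP; first by exists (ev1 g).
  by rewrite /msubst mmapC; apply: mpow_ev1.
move=> [h Hh ->].
have [F HF HFu] := fin_all_exists2 (fun l => IHk _ (Hh l)).
exists (\sum_l F l * 'X_l); first by exists F.
rewrite msubst_sumX -sumrB; apply: mpow_sum => l.
by rewrite -mulrBl; apply: mpow_u.
Qed.

Lemma taylor0 X f : taylor X 0 f = ev1 f. Proof. by []. Qed.

Lemma taylorD X k f g : taylor X k (f + g) = taylor X k f + taylor X k g.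
Proof. by rewrite /taylor iter_lderivD ev1D. Qed.

Lemma taylor_sum X k (I : finType) (F : I -> A) :
  taylor X k (\sum_i F i) = \sum_i taylor X k (F i).
Proof. by rewrite /taylor iter_lderiv_sum ev1_sum. Qed.

Lemma taylorM X k f g : taylor X k (f * g) =
  \sum_(i < k.+1) (taylor X i f * taylor X (k - i) g) *+ 'C(k, i).
Proof.
rewrite /taylor iter_lderivM ev1_sum; apply: eq_bigr => i _.
by rewrite -ev1M /ev1 mevalMn.
Qed.

Lemma taylorC X k c : (0 < k)%N -> taylor X k c%:MP = 0.
Proof. by move=> k0; rewrite /taylor iter_lderivC // /ev1 meval0. Qed.

Lemma taylor1 X f : taylor X 1 f = \sum_l coords X l * ev1 (mderiv l f).
Proof.
rewrite /taylor /= /lderiv ev1_sum; apply: eq_bigr => l _.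
rewrite ev1M; congr (_ * _).
by rewrite /ev1 -mxvec_map map_mxM eval_xmx eval_cmx mul1mx.
Qed.

Lemma taylor_u X l : taylor X 1 (uvar l) = coords X l.
Proof.
rewrite /taylor /= lderivD -mpolyCN lderivC addr0 lderivX /ev1.
by rewrite -mxvec_map map_mxM eval_xmx eval_cmx mul1mx.
Qed.

Lemma taylor_low X k j g : mpow k g -> (j < k)%N -> taylor X j g = 0.
Proof.
elim: k j g => // k IHk j g [h Hh ->]; rewrite ltnS => le_jk.
rewrite taylor_sum big1 // => l _; rewrite taylorM big1 // => i _.
have [lt_ij|ge_ij] := ltnP i j.
  by rewrite (IHk i (h l) (Hh l) (leq_trans lt_ij le_jk)) mul0r mul0rn.
have -> : (j - i = 0)%N by apply/eqP; rewrite subn_eq0.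
by rewrite taylor0 ev1u mulr0 mul0rn.
Qed.

(** In Leibniz' formula the terms differentiating [w] fewer than k times vanish by [taylor_low], and
    the term leaving [uvar l] undifferentiated vanishes at the identity. Only one term remains. *)
Lemma taylor_mulu X k w l :
  mpow k w -> taylor X k.+1 (w * uvar l) = k.+1%:R * taylor X k w * coords X l.
Proof.
move=> Hw; rewrite taylorM !big_ord_recr /= subnn taylor0 ev1u mulr0 mul0rn.
rewrite addr0 subSn // subnn taylor_u big1 => [|i _].
  by rewrite add0r -(bin_sub (leqnSn k)) subSn // subnn bin1 mulr_natl mulrnAl.
by rewrite (taylor_low _ Hw) // mul0r mul0rn.
Qed.

(** Since exp(tX) - 1 has linear part tX, a form of degree k in the [uvar l] restricts to the curve
    as t^k F(X) plus higher terms. *)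
Lemma taylor_form X k F :
  is_form k F -> taylor X k (msubst uvar F) = k`!%:R * F.@[coords X].
Proof.
elim: k F => [|k IHk] F.
  by case=> c ->; rewrite /msubst mmapC /taylor /= ev1C mevalC fact0 mul1r.
move=> [H HH ->]; rewrite msubst_sumX taylor_sum raddf_sum mulr_sumr.
apply: eq_bigr => l _; rewrite taylor_mulu; last exact: mpow_msubst mpow1_u (HH l).
by rewrite (IHk _ (HH l)) /= mevalM mevalXU factS natrM !mulrA.
Qed.

End PowersAtOne.

(** * Krull's intersection theorem at the identity *)

Lemma ideal_sum (R : comNzRingType) (I : R -> Prop) (T : finType) (F : T -> R) :
  is_ideal I -> (forall i, I (F i)) -> I (\sum_i F i).
Proof.
by case=> I0 ID _ IF; apply: (@big_ind _ I) => // i _; apply: IF.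
Qed.

Lemma ideal_coefs (R : comNzRingType) (I : R -> Prop) :
  is_ideal I -> is_ideal (fun p : {poly R} => forall j, I p`_j).
Proof.
move=> idI; have [I0 ID IM] := idI; split=> [j|p q Ip Iq j|a p Ip j].
- by rewrite coef0.
- by rewrite coefD; apply: ID.
- by rewrite coefM; apply: ideal_sum => // i; apply: IM.
Qed.

Section Krull.

Variables (K : numFieldType) (N : nat).
Local Notation A := {mpoly K[N * N]}.
Variable I : A -> Prop.
Hypothesis idI : is_ideal I.

(* The image of [rees] is the Rees algebra of the maximal ideal at the identity. *)
Definition rees (Q : {mpoly A[N * N]}) : {poly A} :=
  mmap (@polyC A) (fun l => (uvar K l)%:P * 'X) Q.

Lemma reesD : {morph rees : p q / p + q}.
Proof. by move=> p q; rewrite /rees rmorphD. Qed.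

Lemma reesM : {morph rees : p q / p * q}.
Proof. by move=> p q; rewrite /rees rmorphM. Qed.

Lemma rees0 : rees 0 = 0. Proof. exact: rmorph0. Qed.
Lemma rees1 : rees 1 = 1. Proof. exact: rmorph1. Qed.

Lemma rees_sum (F : 'I_(N * N) -> {mpoly A[N * N]}) :
  rees (\sum_l F l) = \sum_l rees (F l).
Proof. by rewrite /rees rmorph_sum. Qed.

Lemma rees_mpow k g : mpow k g -> exists Q, rees Q = g *: 'X^k.
Proof.
elim: k g => [|k IHk] g.
  by exists g%:MP; rewrite /rees mmapC expr0 -mul_polyC mulr1.
move=> [h Hh ->].
have [Q HQ] := fin_all_exists (fun l => IHk _ (Hh l)).
exists (\sum_l Q l * 'X_l); rewrite rees_sum scaler_suml.
apply: eq_bigr => l _; rewrite reesM HQ /rees mmapX mmap1U.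
by rewrite exprSr -!mul_polyC polyCM; ring.
Qed.

(** A property of the Rees algebra: its coefficient of t^j lies in m^j, hence vanishes at the
    identity when j is positive. *)
Definition ev1_const (p : {poly A}) : Prop := forall j, (0 < j)%N -> ev1 p`_j = 0.

Lemma ev1_constD p q : ev1_const p -> ev1_const q -> ev1_const (p + q).
Proof. by move=> Hp Hq j j0; rewrite coefD ev1D Hp // Hq // addr0. Qed.

Lemma ev1_constM p q : ev1_const p -> ev1_const q -> ev1_const (p * q).
Proof.
move=> Hp Hq j j0; rewrite coefM ev1_sum big1 // => i _; rewrite ev1M.
have [i0|i0] := posnP i; last by rewrite Hp // mul0r.
by rewrite i0 subn0 Hq // mulr0.
Qed.

Lemma rees_ev1 Q : ev1_const (rees Q).
Proof.
elim/mpoly_ind_ring: Q => [c|l|p q IHp IHq|p q IHp IHq].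
- by move=> j j0; rewrite /rees mmapC coefC eqn0Ngt j0 /ev1 meval0.
- move=> j j0; rewrite /rees mmapX mmap1U coefMX eqn0Ngt j0 /= coefC.
  by case: eqP => _; rewrite ?ev1u // /ev1 meval0.
- by rewrite reesD; apply: ev1_constD.
- by rewrite reesM; apply: ev1_constM.
Qed.

Lemma krull (f : A) : (forall k, exists2 g, mpow k g & I (f - g)) ->
  exists2 a, ev1 a = 1 & I (a * f).
Proof.
move=> Hf; have idP := ideal_coefs idI; have [I0 ID IM] := idI.
pose PI (p : {poly A}) := forall j, I p`_j.
have [P0 PD PM] : is_ideal PI := idP.
have eqB (x y z t : {poly A}) : x + y - (z + t) = (x - z) + (y - t).
  by rewrite opprD addrACA.
have eqM (x y z : {poly A}) : x * y * z = x * (y * z) by rewrite mulrA.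
(* With t for the variable, [J k] consists of the [Q] whose image lies, modulo [I], in the ideal of
   the Rees algebra generated by f t, ..., f t^k. *)
pose tail k (q : nat -> {mpoly A[N * N]}) :=
  \sum_(i < k) rees (q i) * (f *: 'X^(i.+1)).
pose J k Q := exists q, PI (rees Q - tail k q).
have Jid k : is_ideal (J k).
  split.
  - exists (fun=> 0); rewrite /tail big1 => [|i _]; last by rewrite rees0 mul0r.
    by rewrite rees0 subrr; exact: P0.
  - move=> Q Q' [q Hq] [q' Hq']; exists (fun i => q i + q' i).
    have -> : tail k (fun i => q i + q' i) = tail k q + tail k q'.
      rewrite /tail -big_split; apply: eq_bigr => i _ /=.
      by rewrite reesD mulrDl.
    by rewrite reesD eqB; exact: PD Hq Hq'.
  - move=> a Q [q Hq]; exists (fun i => a * q i).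
    have -> : tail k (fun i => a * q i) = rees a * tail k q.
      by rewrite /tail mulr_sumr; apply: eq_bigr => i _; rewrite reesM eqM.
    by rewrite reesM -mulrBr; exact: PM Hq.
have Jinc k Q : J k Q -> J k.+1 Q.
  move=> [q Hq]; exists (fun i => if i == k then 0 else q i).
  rewrite /tail big_ord_recr /= eqxx rees0 mul0r addr0.
  suff <- : tail k q = \sum_(i < k) rees (if i == k :> nat then 0 else q i) * (f *: 'X^(i.+1)).
    exact: Hq.
  by apply: eq_bigr => i _; rewrite ltn_eqF.
have noe : noetherian {mpoly A[N * N]}.
  by do 2!apply: noetherian_mpoly; apply: noetherian_field.
have [k Hk] := noe J Jid Jinc.
(* Modulo [I], f t^(k+1) equals g t^(k+1), which is in the Rees algebra because [g] is in m^(k+1).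
   As the chain is stationary, it is a combination of f t, ..., f t^k. *)
have [g Hg Ifg] := Hf k.+1; have [Q HQ] := rees_mpow Hg.
have : J k.+1 Q.
  exists (fun i => if i == k then 1 else 0).
  have -> : tail k.+1 (fun i => if i == k then 1 else 0) = f *: 'X^(k.+1).
    rewrite /tail big_ord_recr /= eqxx rees1 mul1r big1 ?add0r // => i _.
    by rewrite ltn_eqF // rees0 mul0r.
  rewrite HQ -scalerBl => j; rewrite coefZ mulrC; apply: (IM).
  by rewrite -opprB -mulN1r; apply: IM.
move=> /Hk[q /(_ k.+1)]; rewrite HQ coefB coefZ coefXn eqxx mulr1.
rewrite /tail coef_sum => Ik.
(* This factor comes from comparing the coefficients of t^(k+1). The indices k - i are positive, so
   the sum vanishes at the identity. *)
exists (1 - \sum_(i < k) (rees (q i))`_(k - i)).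
  rewrite ev1B ev1_sum /ev1 meval1 big1 ?subr0 // => i _.
  by apply: rees_ev1; rewrite subn_gt0.
have -> : (1 - \sum_(i < k) (rees (q i))`_(k - i)) * f =
  (f - g) + (g - \sum_(i < k) (rees (q i) * (f *: 'X^(i.+1)))`_k.+1).
  rewrite addrA subrK mulrBl mul1r mulr_suml; congr (_ - _).
  apply: eq_bigr => i _; rewrite -scalerAr coefZ coefMXn.
  by rewrite ltnS ltnNge (ltnW (ltn_ord i)) /= subSS mulrC.
exact: ID.
Qed.

End Krull.

(** * Functions flat at the identity of an algebraic group *)

(** Adjoining a vector of [V] that is still missing raises the rank, which cannot exceed n; the
    counter [k] measures the remaining room. *)
Lemma subspace_mx (F : fieldType) n (V : 'rV[F]_n -> Prop) :
  V 0 -> (forall a u v, V u -> V v -> V (a *: u + v)) ->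
  exists M : 'M[F]_n, forall v, V v <-> (v <= M)%MS.
Proof.
move=> V0 VD.
have Vsub (M : 'M[F]_n) : (forall i, V (row i M)) -> forall v, (v <= M)%MS -> V v.
  move=> VM v /submxP[w ->]; rewrite mulmx_sum_row.
  apply: (@big_ind _ V) => [|x y Vx Vy|i _] //.
  - by rewrite -[x]scale1r; apply: VD.
  - by rewrite -[_ *: _]addr0; apply: VD.
suff main k (M : 'M[F]_n) : (forall i, V (row i M)) -> (n < k + \rank M)%N ->
    exists M' : 'M[F]_n, forall v, V v <-> (v <= M')%MS.
  apply: (main n.+1 0); last by rewrite mxrank0 addn0.
  by move=> i; rewrite row0.
elim: k M => [|k IHk] M VM; first by rewrite add0n ltnNge rank_leq_row.
move=> lt_n; have [full|] := classic (forall v, V v -> (v <= M)%MS).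
  by exists M => v; split; [apply: full|apply: Vsub].
move=> /not_all_ex_not[v nv]; have [Vv nvM] := imply_to_and _ _ nv.
have Vs w : (w <= M + v)%MS -> V w.
  move=> /sub_addsmxP[[a b] -> /=].
  rewrite -[a *m M]scale1r; apply: (VD); first by apply: (Vsub M) => //; apply: submxMl.
  by rewrite [b]mx11_scalar mul_scalar_mx -[_ *: v]addr0; apply: VD.
apply: (IHk (M + v)%MS); first by move=> i; apply: Vs; apply: row_sub.
apply: leq_trans lt_n _; rewrite addSnnS leq_add2l.
apply: rank_ltmx; rewrite /ltmx addsmxSl /=; apply/negP => sub.
by apply: nvM; apply: submx_trans sub; apply: addsmxSr.
Qed.

Section Flat.

Variables (K : numFieldType) (N : nat).
Local Notation A := {mpoly K[N * N]}.
Variable G : 'M[K]_N -> Prop.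
Implicit Types (X g : 'M[K]_N) (f : A).

Definition van f : Prop := forall g, G g -> f.@[coords g] = 0.

(** The tangent space at the identity, taken with respect to the full ideal of polynomials vanishing
    on [G]. *)
Definition lie X : Prop := forall f, van f -> taylor X 1 f = 0.

Definition flat f : Prop := forall X, lie X -> forall k, taylor X k f = 0.

Hypothesis G1 : G 1%:M.
Hypothesis GM : forall g h, G g -> G h -> G (g *m h).

Lemma van_ideal : is_ideal van.
Proof.
split=> [g _|f f' Hf Hf' g Gg|a f Hf g Gg]; first by rewrite meval0.
- by rewrite mevalD Hf ?Hf' ?addr0.
- by rewrite mevalM Hf ?mulr0.
Qed.

Lemma van_ltrans g f : G g -> van f -> van (ltrans g f).
Proof. by move=> Gg Hf h Gh; rewrite ltrans_eval Hf //; apply: GM. Qed.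

(** By left invariance, the value at g of the derivative of [f] is the value at 1 of the derivative
    of the translate of [f] by g, which also vanishes on [G]. *)
Lemma van_lderiv X f : lie X -> van f -> van (lderiv X f).
Proof.
move=> LX Hf g Gg; have := LX _ (van_ltrans Gg Hf).
by rewrite /taylor /= lderiv_ltrans /ev1 ltrans_eval mulmx1.
Qed.

Lemma van_flat f : van f -> flat f.
Proof.
move=> Hf X LX k; suff : van (iter k (lderiv X) f) by apply.
by elim: k => //= k; apply: van_lderiv.
Qed.

(* [w] is the composition of [uvar] with a linear projection onto [lie]. *)
Lemma lie_projection :
  exists w : 'I_(N * N) -> A,
    [/\ forall l, mpow 1 (w l),
        forall v, exists2 X, lie X & forall l, (w l).@[v] = coords X l
      & forall l, exists2 p, van p & mpow 2 (uvar K l - w l - p)].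
Proof.
pose dv f : 'rV[K]_(N * N) := \row_l ev1 (mderiv l f).
have [I0 ID IM] := van_ideal.
have [M HM] : exists M : 'M_(N * N), forall v,
    (exists2 p, van p & v = dv p) <-> (v <= M)%MS.
  apply: subspace_mx.
    by exists 0 => //; apply/rowP => l; rewrite !mxE mderiv0 /ev1 meval0.
  move=> a _ _ [p Ip ->] [q Iq ->]; exists (a%:MP * p + q).
    by apply: (ID) => //; apply: (IM).
  by apply/rowP => l; rewrite !mxE mderivD mderiv_mulC ev1D ev1M ev1C.
have lieE X : mxvec X *m M^T = 0 -> lie X.
  move=> XM f vf; have /HM/submxP[y dvf] : exists2 p, van p & dv f = dv p by exists f.
  rewrite taylor1.
  transitivity ((mxvec X *m (dv f)^T) 0 0).
    by rewrite mxE; apply: eq_bigr => l _; rewrite !mxE.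
  by rewrite dvf trmx_mul mulmxA XM mul0mx !mxE.
(* [Pm] projects onto the vectors annihilated by all differentials in [M], hence into [lie]. The
   columns of [1%:M - Pm], transposed, lie in [M], so they are differentials of elements of the
   ideal. *)
pose Pm : 'M_(N * N) := 1%:M - M^T *m pinvmx M^T.
have PmM : Pm *m M^T = 0.
  by rewrite mulmxBl mul1mx mulmxKpV ?subrr.
pose w l : A := \sum_j (Pm j l)%:MP * uvar K j.
exists w; split.
- by move=> l; apply: mpow_sum => j; apply: mpowM; apply: mpow1_u.
- move=> v; pose y : 'rV[K]_(N * N) := \row_j (v j - coords 1%:M j).
  exists (vec_mx (y *m Pm)); first by apply: lieE; rewrite vec_mxK -mulmxA PmM mulmx0.
  move=> l; rewrite /coords vec_mxK mxE raddf_sum; apply: eq_bigr => j _ /=.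
  by rewrite mevalM mevalC mevalB mevalXU mevalC [y 0 j]mxE mulrC.
- move=> l.
  have /HM[p Ip dvp] : (row l (1%:M - Pm)^T <= M)%MS.
    rewrite /Pm opprB addrC subrK trmx_mul trmxK row_mul.
    exact: submxMl.
  exists p => //; rewrite -opprB; apply: mpowN.
  have -> : uvar K l - w l = \sum_j (ev1 (mderiv j p))%:MP * uvar K j.
    transitivity (\sum_j ((1%:M - Pm) j l)%:MP * uvar K j).
      rewrite /w; under [RHS]eq_bigr => j _ do
        rewrite [(1%:M - Pm) j l]mxE [(- Pm) j l]mxE [1%:M j l]mxE mpolyCB mulrBl.
      rewrite sumrB; congr (_ - _); rewrite (bigD1 l) //= eqxx big1 ?addr0.
        by rewrite mpolyC1 mul1r.
      by move=> j /negPf ->; rewrite mpolyC0 mul0r.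
    apply: eq_bigr => j _; have /rowP/(_ j) := dvp.
    by rewrite [RHS]mxE [LHS]mxE [LHS]mxE => ->.
  have -> : p - \sum_j (ev1 (mderiv j p))%:MP * uvar K j =
    p - (ev1 p)%:MP - \sum_j (ev1 (mderiv j p))%:MP * uvar K j.
    by rewrite /ev1 Ip // mpolyC0 subr0.
  exact: mpow_linear.
Qed.

(** Induction on k: by flatness the leading form of the current remainder vanishes on [lie]. Such a
    form in the [uvar l] is congruent to an element of the ideal modulo the next power of m, so it
    can be removed. *)
Lemma flat_mpow f k : flat f -> exists2 g, mpow k g & van (f - g).
Proof.
move=> Ff; have [I0 ID IM] := van_ideal.
have [w [w1 wlie wapx]] := lie_projection.
(* Replacing each [uvar l] by [w l] changes a form of degree j only by an element of the ideal and
   one of m^(j+1). *)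
have reduce j F : is_form j F ->
    exists2 p, van p & mpow j.+1 (msubst (@uvar K N) F - msubst w F - p).
  elim: j F => [|j IHj] F.
    by move=> [c ->]; exists 0; rewrite // /msubst !mmapC !subrr; apply: mpow_zero.
  move=> [H HH ->]; rewrite !msubst_sumX.
  have [p Ip Hp] := fin_all_exists2 (fun l => IHj _ (HH l)).
  have [q Iq Hq] := fin_all_exists2 wapx.
  exists (\sum_l (msubst (@uvar K N) (H l) * q l + w l * p l)).
    by apply: (ideal_sum van_ideal) => l; apply: (ID); apply: (IM); [apply: Iq|apply: Ip].
  rewrite -!sumrB; apply: mpow_sum => l.
  have telescope (a b u v x y : A) :
    a * u - b * v - (a * x + v * y) = a * (u - v - x) + v * (a - b - y) by ring.
  rewrite telescope.
  apply: mpowD; last exact: (mpow_mul (w1 l) (Hp l)).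
  rewrite -addn2; apply: mpow_mul (Hq l); apply: mpow_msubst (HH l).
  exact: mpow1_u.
elim: k => [|k [g Hg Ig]]; first by exists f => //; rewrite subrr.
have [F HF Hlead] := leading_form Hg.
(* The values of [w] are coordinates of elements of [lie], where [F] vanishes by [taylor_form]. *)
have wF0 : msubst w F = 0.
  apply: mpoly_eq0 => v; rewrite msubst_eval.
  have [X LX HX] := wlie v; rewrite (meval_eq _ HX).
  have : taylor X k f = 0 by apply: Ff.
  have -> : f = (f - g) + ((g - msubst (@uvar K N) F) + msubst (@uvar K N) F) by rewrite !subrK.
  rewrite (taylorD X k (f - g)) (taylorD X k (g - _)) (taylor_low _ Hlead) // add0r.
  rewrite (taylor_form _ HF).
  rewrite (van_flat Ig LX) add0r => /eqP.
  by rewrite mulf_eq0 pnatr_eq0 eqn0Ngt fact_gt0 => /eqP.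
have [p Ip Hp] := reduce _ _ HF; rewrite wF0 subr0 in Hp.
exists (g - p).
  have -> : g - p = (g - msubst (@uvar K N) F) + (msubst (@uvar K N) F - p).
    by rewrite addrA subrK.
  exact: mpowD.
by rewrite opprB addrA addrAC; apply: ID.
Qed.

Lemma flat_germ f : flat f -> exists2 a, ev1 a = 1 & van (a * f).
Proof. by move=> Ff; apply: (krull van_ideal) => k; apply: flat_mpow. Qed.

End Flat.

(** * Primality of the ideal of flat functions *)

Lemma min_ex (Pr : nat -> Prop) :
  (exists n, Pr n) -> exists2 n, Pr n & forall m, (m < n)%N -> ~ Pr m.
Proof.
move=> [n Pn]; apply: NNPP => none.
have [m] := ubnP n; elim: m n Pn => // m IHm n Pn; rewrite ltnS => le_nm.
apply: none; exists n => // j lt_jn Pj.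
by apply: (IHm j) => //; apply: leq_trans lt_jn le_nm.
Qed.

(** A derivation applied to the value of a polynomial at a constant again gives the value of a fixed
    polynomial. This keeps the dependence on the parameter [s] polynomial in [taylor_line]. *)
Lemma horner_derivation (R : comNzRingType) (D : R -> R) (p : {poly R}) :
  {morph D : x y / x + y} -> (forall x y, D (x * y) = D x * y + x * D y) ->
  exists p' : {poly R}, forall c, D c = 0 -> D p.[c] = p'.[c].
Proof.
move=> DD DM; have D0 : D 0 = 0 by apply: (addrI (D 0)); rewrite -DD !addr0.
elim/poly_ind: p => [|p a [p' Hp']]; first by exists 0 => s _; rewrite !horner0.
exists (p' * 'X + (D a)%:P) => s Ds.
by rewrite !hornerMXaddC DD DM Hp' // Ds mulr0 addr0.
Qed.

Lemma horner_comm_step (R : comNzRingType) (p q : {poly R}) c :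
  p.[c] + c * q.[c] = (p + q * 'X).[c].
Proof. by rewrite hornerD hornerMX mulrC. Qed.

Section FlatPrime.

Variables (K : numFieldType) (N : nat).
Local Notation A := {mpoly K[N * N]}.
Implicit Types (X Y : 'M[K]_N) (f : A).

Lemma taylor_line X Y k f :
  exists q : {poly K}, forall s, taylor (X + s *: Y) k f = q.[s].
Proof.
have [R HR] : exists R : {poly A},
    forall s, iter k (lderiv (X + s *: Y)) f = R.[s%:MP].
  elim: k => [|k [R HR]]; first by exists f%:P => s; rewrite hornerC.
  have [R1 HR1] := horner_derivation R (@lderivD _ _ X) (@lderivM _ _ X).
  have [R2 HR2] := horner_derivation R (@lderivD _ _ Y) (@lderivM _ _ Y).
  exists (R1 + R2 * 'X) => s.
  rewrite -horner_comm_step iterS HR lderiv_line.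
  by rewrite -HR1 ?lderivC // -HR2 ?lderivC.
exists (map_poly (meval (coords 1%:M)) R) => s.
by rewrite /taylor HR -{2}[s](@mevalC (N * N) _ (coords 1%:M) s) horner_map.
Qed.

Variable G : 'M[K]_N -> Prop.

Lemma lie_line X Y s : lie G X -> lie G Y -> lie G (X + s *: Y).
Proof.
move=> LX LY f vf; rewrite /taylor /= lderiv_line ev1D ev1M.
by rewrite -[ev1 (lderiv X f)]/(taylor X 1 f) -[ev1 (lderiv Y f)]/(taylor Y 1 f)
  LX // LY // mulr0 addr0.
Qed.

(** Let k and l be the lowest orders at which [f] and [g] have a nonzero derivative along some
    element of [lie]. Both are nonzero along a common [Z], and then the derivative of order k + l of
    the product is nonzero too. *)
Lemma flat_prime f g : flat G (f * g) -> flat G f \/ flat G g.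
Proof.
move=> Ffg; apply: NNPP => /not_or_and[nf ng].
have low h : ~ flat G h -> exists k X,
    [/\ lie G X, taylor X k h != 0 &
        forall j Y, lie G Y -> (j < k)%N -> taylor Y j h = 0].
  move=> nh; have [|k [X LX Xk] kmin] :=
    @min_ex (fun k => exists2 X, lie G X & taylor X k h != 0).
    apply: NNPP => none; apply: nh => X LX k; apply/eqP/negPn/negP => h0.
    by apply: none; exists k, X.
  exists k, X; split=> // j Y LY lt_jk; apply/eqP/negPn/negP => h0.
  by apply: (kmin j) => //; exists Y.
have [k [X [LX Xk kmin]]] := low _ nf; have [l [Y [LY Yl lmin]]] := low _ ng.
have [q1 Hq1] := taylor_line X (Y - X) k f.
have [q2 Hq2] := taylor_line X (Y - X) l g.
have q10 : q1 != 0.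
  apply: contraNneq Xk => q10; have := Hq1 0.
  by rewrite scale0r addr0 q10 horner0 => ->.
have q20 : q2 != 0.
  apply: contraNneq Yl => q20; have := Hq2 1.
  by rewrite scale1r addrC subrK q20 horner0 => ->.
(* On the line through [X] and [Y] the two derivatives are polynomials in s, nonzero at s = 0 and at
   s = 1 respectively, so some natural s avoids the roots of both. *)
have [s] : exists s : nat, (q1 * q2).[s%:R] != 0.
  by apply: poly_nonroot; rewrite mulf_neq0.
have LYX : lie G (Y - X) by rewrite -scaleN1r; exact: lie_line LY LX.
have LZ := lie_line s%:R LX LYX; move: LZ; rewrite hornerM -Hq1 -Hq2.
set Z := X + _ => LZ /negP; apply; have := Ffg Z LZ (k + l)%N; rewrite taylorM.
have lt_k : (k < (k + l).+1)%N by rewrite ltnS leq_addr.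
(* Every other Leibniz term differentiates [f] fewer than k times or [g] fewer than l times. *)
rewrite (bigD1 (Ordinal lt_k)) //= addKn big1 ?addr0 => [/eqP|i ne_ik].
  by rewrite mulrn_eq0 -leqn0 leqNgt bin_gt0 leq_addr.
have [lt_ik|] := ltnP i k; first by rewrite kmin // mul0r mul0rn.
rewrite leq_eqVlt => /predU1P[eq_ik|lt_ki].
  by case/eqP: ne_ik; apply: val_inj.
rewrite lmin ?mulr0 ?mul0rn //.
by move: lt_ki (ltn_ord i) => /=; lia.
Qed.

End FlatPrime.

(** * Connected groups are locally, hence globally, irreducible *)

Section Germ.

Variables (K : numFieldType) (N : nat).
Local Notation A := {mpoly K[N * N]}.
Variable G : 'M[K]_N -> Prop.
Hypothesis G1 : G 1%:M.
Hypothesis GM : forall g h, G g -> G h -> G (g *m h).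
Hypothesis GV : forall g, G g -> G (invmx g).
Hypothesis Gunit : forall g, G g -> g \in unitmx.
Implicit Types (x y g : 'M[K]_N) (f : A).

(** The polynomials that vanish on a Zariski neighbourhood of [x] in [G], with [b] as the
    denominator that defines the neighbourhood. *)
Definition germ x f : Prop := exists2 b : A, b.@[coords x] != 0 & van G (b * f).

Lemma germ_ideal x : is_ideal (germ x).
Proof.
have [I0 ID IM] := van_ideal G; split.
- by exists 1; rewrite ?meval1 ?oner_eq0 // mulr0.
- move=> f f' [b b0 vb] [b' b'0 vb']; exists (b * b').
    by rewrite mevalM mulf_neq0.
  have -> : b * b' * (f + f') = b' * (b * f) + b * (b' * f') by ring.
  by apply: (ID); apply: (IM).
- move=> a f [b b0 vb]; exists b => //.
  by rewrite mulrCA; apply: IM.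
Qed.

Lemma germ_ltrans g x f : G g -> germ (g *m x) f <-> germ x (ltrans g f).
Proof.
move=> Gg; split=> [] [b b0 vb].
  exists (ltrans g b); first by rewrite ltrans_eval.
  by rewrite -ltransM; apply: van_ltrans.
exists (ltrans (invmx g) b).
  by rewrite ltrans_eval mulmxA mulVmx ?Gunit // mul1mx.
have -> : ltrans (invmx g) b * f = ltrans (invmx g) (b * ltrans g f).
  by rewrite ltransM ltransA mulmxV ?Gunit // ltrans1.
by apply: van_ltrans => //; apply: GV.
Qed.

Lemma noetherian_A : noetherian A.
Proof. by apply: noetherian_mpoly; apply: noetherian_field. Qed.

(* Translation by [g := y x^-1] carries one germ ideal to the other, so a strict
   inclusion would iterate to a strictly increasing chain. *)
Lemma germ_sub_eq x y : G x -> G y -> (forall f, germ x f -> germ y f) ->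
  forall f, germ y f -> germ x f.
Proof.
move=> Gx Gy sub.
pose g := y *m invmx x; have Gg : G g by apply: GM => //; apply: GV.
have defy : y = g *m x by rewrite /g -mulmxA mulVmx ?Gunit // mulmx1.
have germ_g f : germ y f <-> germ x (ltrans g f) by rewrite defy; apply: germ_ltrans.
pose I k f := germ x (iter k (ltrans g) f).
have [||k Hk] := noetherian_A (I := I).
- move=> k; have [I0 ID IM] := germ_ideal x.
  have T0 : iter k (ltrans g) 0 = 0 :> A.
    by elim: k => //= k ->; rewrite -mpolyC0 ltransC.
  have TD f f' : iter k (ltrans g) (f + f') = iter k (ltrans g) f + iter k (ltrans g) f'.
    by elim: k {T0} => //= k ->; rewrite ltransD.
  have TM f f' : iter k (ltrans g) (f * f') = iter k (ltrans g) f * iter k (ltrans g) f'.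
    by elim: k {T0 TD} => //= k ->; rewrite ltransM.
  rewrite /I; split=> [|f f'|a f].
  + by rewrite T0.
  + by rewrite TD; apply: ID.
  + by rewrite TM; apply: IM.
- by move=> k f If; rewrite /I iterS; apply/germ_g/sub.
move=> f /germ_g xf.
pose f' := iter k (ltrans (invmx g)) f.
have f'K : iter k (ltrans g) f' = f.
  rewrite /f'; elim: (k) => // j IHj; rewrite iterSr iterS ltransA.
  by rewrite mulVmx ?Gunit // ltrans1.
by have := Hk k.+1 f'; rewrite /I iterS f'K; apply.
Qed.

(** One denominator serves the whole germ ideal. Otherwise further factors could be multiplied in
    forever, each strictly enlarging the ideal of those f for which [B k * f] vanishes on [G]. *)
Lemma germ_uniform x :
  exists2 b : A, b.@[coords x] != 0 & forall f, germ x f -> van G (b * f).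
Proof.
apply: NNPP => none.
have step (b : A) : exists c : A, b.@[coords x] != 0 ->
    c.@[coords x] != 0 /\ exists2 f, van G (c * b * f) & ~ van G (b * f).
  have [b0|] := classic (b.@[coords x] != 0); last by exists 0.
  have [f] : exists f, ~ (germ x f -> van G (b * f)).
    by apply: not_all_ex_not => all; apply: none; exists b.
  move=> nb0; have [[c c0 vc] nb] := imply_to_and _ _ nb0.
  exists c => _; split=> //; exists f => //.
  by rewrite -mulrA mulrCA; have [_ _ IM] := van_ideal G; apply: IM.
pose nx b := proj1_sig (constructive_indefinite_description _ (step b)).
have nxP b : b.@[coords x] != 0 -> (nx b).@[coords x] != 0 /\
    exists2 f, van G (nx b * b * f) & ~ van G (b * f).
  by rewrite /nx; case: constructive_indefinite_description.
pose B k := iter k (fun b => nx b * b) 1.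
have B0 k : (B k).@[coords x] != 0.
  elim: k => [|k IHk]; first by rewrite meval1 oner_eq0.
  by rewrite /B iterS mevalM mulf_neq0 //; have [] := nxP _ IHk.
have [I0 ID IM] := van_ideal G.
have [||k Hk] := noetherian_A (I := fun k f => van G (B k * f)).
- move=> k; split=> [|f f'|a f].
  + by rewrite mulr0.
  + by rewrite mulrDr; apply: ID.
  + by move=> vf; rewrite mulrCA; apply: IM.
- by move=> k f vf; rewrite /B iterS -mulrA; apply: IM.
by have [_ [f vf nf]] := nxP _ (B0 k); apply/nf/(Hk k.+1).
Qed.

End Germ.

(** The points of [G] with the same germ ideal as 1 form a set that is closed and has closed
    complement, so by connectedness it is all of [G]. A flat function is in the germ ideal at 1 by
    [flat_germ]. *)
Lemma flat_van N (G : 'M[CC]_N -> Prop) f :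
  is_subgroup G -> (forall g, G g -> g \in unitmx) -> zconnected G ->
  flat G f -> van G f.
Proof.
move=> [G1 GM GV] Gu conn Ff.
(* An inclusion suffices here, since inclusions between germ ideals at points of [G] are equalities
   by [germ_sub_eq]. *)
pose near1 x := forall h, germ G 1%:M h -> germ G x h.
pose B1 x := G x /\ near1 x; pose B2 x := G x /\ ~ near1 x.
have near_sym x y (b : {mpoly CC[N * N]}) : G x -> G y ->
    (forall h, germ G x h -> van G (b * h)) ->
    b.@[coords y] != 0 -> forall h, germ G x h <-> germ G y h.
  move=> Gx Gy Hb by0 h; have sub h' : germ G x h' -> germ G y h'.
    by move=> /Hb; exists b.
  by split; [apply: sub|apply: (germ_sub_eq GM GV Gu Gx Gy sub)].
have cl1 : zclosed_in G B1.
  (* The equations are the uniform denominators of the points outside [B1]. They vanish on [B1] by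
     [near_sym], while a point outside has a denominator of its own that is nonzero there. *)
  exists (fun b => exists x, [/\ G x, ~ near1 x &
    forall h, germ G x h -> van G (b * h)]) => y; split.
    move=> [Gy y1]; split=> // b [x [Gx nx Hb]]; apply/eqP/negPn/negP => by0.
    by apply: nx => h h1; apply: (proj2 (near_sym x y b Gx Gy Hb by0 h)); apply: y1.
  move=> [Gy Hy]; split=> //; apply: NNPP => ny1.
  have [b b0 Hb] := germ_uniform G y.
  by move/eqP: b0; apply; apply: Hy; exists y.
have cl2 : zclosed_in G B2.
  exists (fun b => exists x, [/\ G x, near1 x &
    forall h, germ G x h -> van G (b * h)]) => y; split.
    move=> [Gy ny1]; split=> // b [x [Gx x1 Hb]]; apply/eqP/negPn/negP => by0.
    by apply: ny1 => h h1; apply: (proj1 (near_sym x y b Gx Gy Hb by0 h)); apply: x1.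
  move=> [Gy Hy]; split=> // y1.
  have [b b0 Hb] := germ_uniform G y.
  by move/eqP: b0; apply; apply: Hy; exists y.
have [||all1|all2] := conn _ _ cl1 cl2.
- by move=> g Gg; have [] := classic (near1 g); [left|right].
- by move=> g [[_ g1] [_ ng1]].
- have [a a1 va] := flat_germ G1 GM Ff.
  have f1 : germ G 1%:M f by exists a; rewrite // -/(ev1 a) a1 oner_eq0.
  move=> g Gg; have [_ /(_ f f1)[b b0 vb]] := all1 g Gg.
  by have /eqP := vb g Gg; rewrite mevalM mulf_eq0 (negPf b0) => /eqP.
- by have [_ []] := all2 _ G1.
Qed.

(** * The exponential map *)

Definition powser (a : nat -> RR) (t l : RR) : Prop :=
  @Series.is_series Hierarchy.R_AbsRing Hierarchy.R_NormedModule
    (fun n : nat => a n * t ^+ n) l.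

Definition entire (a : nat -> RR) : Prop := forall t, exists l, powser a t l.

Lemma powserE a t l : powser a t l <->
  @PSeries.is_pseries Hierarchy.R_AbsRing Hierarchy.R_NormedModule a t l.
Proof.
split=> H; last first.
  apply: Series.is_series_ext (proj1 (PSeries.is_pseries_R a t l) H) => n.
  by rewrite RpowE.
apply: (proj2 (PSeries.is_pseries_R a t l)).
by apply: Series.is_series_ext H => n; rewrite RpowE.
Qed.

Lemma powser_ext a b t l : a =1 b -> powser a t l -> powser b t l.
Proof. by move=> eq_ab; apply: Series.is_series_ext => n; rewrite eq_ab. Qed.

Lemma powser_unique a t l l' : powser a t l -> powser a t l' -> l = l'.
Proof.
move=> /powserE/PSeries.is_pseries_unique <-.
by move=> /powserE/PSeries.is_pseries_unique <-.
Qed.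

Lemma powser_const (c t : RR) : powser (fun n => if n == 0%N then c else 0) t c.
Proof.
rewrite /powser /Series.is_series.
refine (Hierarchy.filterlim_ext (F := Hierarchy.eventually) (fun _ => c) _ _ _);
  last exact (@Hierarchy.filterlim_const nat
    (Hierarchy.NormedModule.UniformSpace _ Hierarchy.R_NormedModule)
    Hierarchy.eventually Hierarchy.filter_filter c).
elim=> [|n IHn]; first by rewrite Hierarchy.sum_O /= expr0 mulr1.
by rewrite Hierarchy.sum_Sn -IHn mul0r; exact/esym/addr0.
Qed.

Lemma powserD a b t l l' :
  powser a t l -> powser b t l' -> powser (fun n => a n + b n) t (l + l').
Proof.
move=> /powserE Ha /powserE Hb; apply/powserE.
exact: PSeries.is_pseries_plus Ha Hb.
Qed.

Lemma entire_radius a (x : RR) :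
  entire a -> Rbar.Rbar_lt (Rbar.Finite (Rbasic_fun.Rabs x)) (PSeries.CV_radius a).
Proof.
move=> ent; apply: Rbar.Rbar_not_le_lt => le_rad.
have [l Hl] := ent (`|x| + 1).
apply: (PSeries.CV_disk_outside a (`|x| + 1 : RR)).
  apply: Rbar.Rbar_le_lt_trans le_rad _ => /=; apply/RltP.
  by rewrite !RabsE (ger0_norm (addr_ge0 (normr_ge0 x) ler01)) ltrDl ltr01.
apply: Lim_seq.is_lim_seq_ext (Series.ex_series_lim_0 _ (ex_intro _ l Hl)) => n.
by rewrite RpowE.
Qed.

Lemma powserM a b t l l' : entire a -> entire b ->
  powser a t l -> powser b t l' ->
  powser (fun n => \sum_(i < n.+1) a i * b (n - i)%N) t (l * l').
Proof.
move=> ea eb /powserE Ha /powserE Hb.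
have /powserE := PSeries.is_pseries_mult _ _ _ _ _ Ha Hb
  (entire_radius _ ea) (entire_radius _ eb).
by apply: powser_ext => n; rewrite /PSeries.PS_mult sum_f_R0E big_mkord.
Qed.

Lemma powser_eq0 a : (forall t, powser a t 0) -> forall n, a n = 0.
Proof.
move=> a0 n; have ent : entire a by move=> t; exists 0.
apply: (PSeries.PSeries_ext_recip a (fun _ => Rdefinitions.IZR BinNums.Z0)).
- by have := entire_radius 0 ent; rewrite RabsE normr0.
- by rewrite PSeries.CV_radius_const_0.
- exists (RIneq.mkposreal _ RIneq.Rlt_0_1) => y _.
  rewrite PSeries.PSeries_const_0; apply: PSeries.is_pseries_unique.
  exact/powserE/a0.
Qed.

Lemma entire_exp_bound (a : nat -> RR) (B : RR) :
  (forall n, `|a n| <= B ^+ n / n`!%:R) -> entire a.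
Proof.
move=> le_aB t.
have /powserE Hexp := ElemFct.is_exp_Reals (B * `|t|).
have [l Hl] : @Series.ex_series Hierarchy.R_AbsRing Hierarchy.R_NormedModule
    (fun n : nat => a n * t ^+ n).
  apply: (@Series.ex_series_le Hierarchy.R_AbsRing Hierarchy.R_CompleteNormedModule
    _ _ _ (ex_intro _ _ Hexp)) => n.
  rewrite /Hierarchy.norm /= /Hierarchy.abs /=; apply/RleP.
  rewrite RabsE RinvE INRE factE normrM normrX exprMn mulrA.
  by rewrite ler_wpM2r ?exprn_ge0 // mulrC.
by exists l.
Qed.

Section Exponential.

Variables (N : nat) (Z : 'M[RR]_N).

(** Dividing by k! turns Leibniz' formula into the Cauchy product of power series. *)
Definition ocoef (f : {mpoly RR[N * N]}) (k : nat) : RR := taylor Z k f / k`!%:R.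

Lemma ocoefM f g n : ocoef (f * g) n = \sum_(i < n.+1) ocoef f i * ocoef g (n - i)%N.
Proof.
rewrite /ocoef taylorM mulr_suml; apply: eq_bigr => i _.
have le_in : (i <= n)%N by rewrite -ltnS.
have fn0 m : m`!%:R != 0 :> RR by rewrite pnatr_eq0 -lt0n fact_gt0.
rewrite -(bin_fact le_in) !natrM -mulr_natr.
have bn0 : 'C(n, i)%:R != 0 :> RR by rewrite pnatr_eq0 -lt0n bin_gt0.
by field; rewrite !fn0 bn0.
Qed.

Lemma entire_ocoefX l : entire (ocoef 'X_l).
Proof.
(* Every row sum of the absolute values in [Z] is at most [B], so the entries of Z^n are bounded by
   [B ^+ n]. *)
pose B := \sum_i \sum_j `|Z i j|.
apply: (@entire_exp_bound _ B) => n.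
rewrite /ocoef normrM [`|_^-1|]ger0_norm ?invr_ge0 ?ler0n //.
rewrite ler_wpM2r ?invr_ge0 ?ler0n // /taylor lderiv_xmx /ev1 -mxvec_map.
rewrite map_mxM eval_xmx eval_cmx mul1mx.
case/mxvec_indexP: l => i j; rewrite mxvecE.
elim: n i => [|n IHn] i.
  by rewrite /= mxE expr0; case: eqP => _; rewrite ?normr1 ?normr0.
rewrite iterS mxE exprS; apply: le_trans (ler_norm_sum _ _ _) _.
apply: (@le_trans _ _ (\sum_m `|Z i m| * B ^+ n)).
  by apply: ler_sum => m _; rewrite normrM ler_wpM2l.
have B0 : 0 <= B by apply: sumr_ge0 => m _; apply: sumr_ge0.
rewrite -mulr_suml ler_wpM2r ?exprn_ge0 // /B [X in _ <= X](bigD1 i) //= lerDl.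
by apply: sumr_ge0 => m _; apply: sumr_ge0.
Qed.

(** [Y t] is exp(tZ), defined entrywise by its convergent series. The expansion of an arbitrary
    polynomial along it follows by sums and Cauchy products. *)
Lemma exists_orbit : exists Y : RR -> 'M[RR]_N,
  forall f t, powser (ocoef f) t f.@[coords (Y t)].
Proof.
have Yl l t : exists y, powser (ocoef 'X_l) t y := entire_ocoefX l t.
pose y t l := proj1_sig (constructive_indefinite_description _ (Yl l t)).
have yP t l : powser (ocoef 'X_l) t (y t l).
  by rewrite /y; case: constructive_indefinite_description.
exists (fun t => vec_mx (\row_l y t l)); elim/mpoly_ind_ring => [c|l|p q IHp IHq|p q IHp IHq] t.
- rewrite mevalC; apply: (@powser_ext (fun n => if n == 0%N then c else 0));
    last exact: powser_const.
  move=> [|k]; first by rewrite /ocoef taylor0 ev1C fact0 divr1.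
  by rewrite /ocoef taylorC // mul0r.
- by rewrite mevalXU /coords vec_mxK mxE.
- rewrite mevalD; apply: (@powser_ext (fun k => ocoef p k + ocoef q k)); last exact: powserD.
  by move=> k; rewrite /ocoef taylorD mulrDl.
- rewrite mevalM.
  have ep : entire (ocoef p) by move=> s; exists (p.@[coords (vec_mx (\row_l y s l))]).
  have eq : entire (ocoef q) by move=> s; exists (q.@[coords (vec_mx (\row_l y s l))]).
  apply: powser_ext; last exact: (powserM ep eq (IHp t) (IHq t)).
  by move=> k; rewrite ocoefM.
Qed.

End Exponential.

(** * Real points are Zariski dense *)

Definition rtoc : {rmorphism RR -> CC} := real_complex RR.

Definition cconj : {rmorphism CC -> CC} := @conjc RR.

Section RealPoints.

Variables (N : nat) (S : {mpoly RR[N * N]} -> Prop).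
Local Notation A := {mpoly CC[N * N]}.
Local Notation G := (HC S).
Hypothesis grpG : is_subgroup G.

Lemma HR_HC h : HR S h -> G (map_mx rtoc h).
Proof.
move=> [hu hS]; split=> [|p Sp]; first by rewrite map_unitmx.
transitivity (rtoc p.@[coords h]); first exact: (meval_map rtoc).
by rewrite -[p.@[_]]/(p.@[coordsR h]) hS // rmorph0.
Qed.

Lemma van_gen p : S p -> van G (map_mpoly rtoc p).
Proof. by move=> Sp g [_]; apply. Qed.

Lemma HC_conj g : G g -> G (map_mx cconj g).
Proof.
move=> [gu gS]; split=> [|p Sp]; first by rewrite map_unitmx.
have conjp : map_mpoly cconj (map_mpoly rtoc p) = map_mpoly rtoc p.
  apply/mpolyP => m; rewrite !mcoeff_map_mpoly; exact: conjc_real.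
transitivity (cconj (map_mpoly rtoc p).@[coords g]).
  by rewrite -meval_map conjp.
by rewrite -[(map_mpoly _ p).@[_]]/(evalC p (coordsC g)) gS // rmorph0.
Qed.

(** The equations in [S] are real, so [G] and its ideal are stable under conjugation; hence so is
    the tangent space. *)
Lemma lie_conj X : lie G X -> lie G (map_mx cconj X).
Proof.
move=> LX f vf.
have conjK (h : A) : map_mpoly cconj (map_mpoly cconj h) = h.
  by apply/mpolyP => m; rewrite !mcoeff_map_mpoly /= conjcK.
have conjKm (M : 'M[CC]_N) : map_mx cconj (map_mx cconj M) = M.
  by apply/matrixP => i j; rewrite !mxE /= conjcK.
have /LX : van G (map_mpoly cconj f).
  move=> g Gg; rewrite -[g]conjKm meval_map vf ?rmorph0 //; exact: HC_conj.
move/(congr1 cconj); rewrite rmorph0 /taylor /= /ev1 -meval_map map_lderiv conjK.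
by rewrite map_mx1.
Qed.

Lemma lie0 : lie G 0.
Proof.
move=> f _; rewrite taylor1 big1 // => l _.
by rewrite /coords linear0 mxE mul0r.
Qed.

Lemma lieZ s X : lie G X -> lie G (s *: X).
Proof. by move=> LX; have := lie_line s lie0 LX; rewrite add0r. Qed.

Lemma lieD X Y : lie G X -> lie G Y -> lie G (X + Y).
Proof. by move=> LX LY; have := lie_line 1 LX LY; rewrite scale1r. Qed.

Lemma lie_decomp X : lie G X -> exists Z1 Z2 : 'M[RR]_N,
  [/\ lie G (map_mx rtoc Z1), lie G (map_mx rtoc Z2)
    & exists i : CC, X = map_mx rtoc Z1 + i *: map_mx rtoc Z2].
Proof.
move=> LX; have LXc := lie_conj LX.
have i0 : ('i%C : CC) != 0.
  by apply/eqP => i0; have /eqP := sqr_i RR; rewrite i0 expr0n /= eq_sym oppr_eq0 oner_eq0.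
exists (map_mx (@complex.Re _) X), (map_mx (@complex.Im _) X).
have conjE (z : CC) : cconj z = rtoc (complex.Re z) - 'i%C * rtoc (complex.Im z).
  rewrite {1}[z]complexE rmorphD rmorphM /=; congr (_ + _).
    exact: conjc_real.
  rewrite -mulNr; congr (_ * _); last exact: conjc_real.
  by apply/eqP; rewrite eq_complex /= oppr0 !eqxx.
have half (a b : CC) : a = 2^-1 * (a + 'i%C * b + (a - 'i%C * b)) by field.
have half_i (a b : CC) : b = (2 * 'i%C)^-1 * (a + 'i%C * b + -1 * (a - 'i%C * b)).
  by field.
have reE : map_mx rtoc (map_mx (@complex.Re _) X) = 2^-1 *: (X + map_mx cconj X).
  by apply/matrixP => i j; rewrite !mxE conjE {2}[X i j]complexE -half.
have imE : map_mx rtoc (map_mx (@complex.Im _) X) =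
    (2 * 'i%C)^-1 *: (X + (-1) *: map_mx cconj X).
  by apply/matrixP => i j; rewrite !mxE conjE {2}[X i j]complexE -half_i.
split.
- by rewrite reE; exact: lieZ (lieD LX LXc).
- by rewrite imE; exact: lieZ (lie_line (-1) LX LXc).
- by exists 'i%C; apply/matrixP => i j; rewrite !mxE {1}[X i j]complexE.
Qed.

(** A defining equation vanishes on [G], so all its derivatives along [Z] at 1 are zero by
    [van_flat], and its power series along the curve is zero. *)
Lemma orbit_HR (Z : 'M[RR]_N) (Y : RR -> 'M[RR]_N) :
  lie G (map_mx rtoc Z) ->
  (forall f t, powser (ocoef Z f) t f.@[coords (Y t)]) ->
  forall t, Y t \in unitmx -> HR S (Y t).
Proof.
move=> LZ HY t Yu; split=> // p Sp; have [G1 GM _] := grpG.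
have c0 k : ocoef Z p k = 0.
  rewrite /ocoef; suff -> : taylor Z k p = 0 by rewrite mul0r.
  apply: (fmorph_inj rtoc); rewrite rmorph0 /taylor /ev1.
  rewrite -(meval_map rtoc) map_iter_lderiv map_mx1.
  exact: (van_flat G1 GM (van_gen Sp) LZ k).
apply: (powser_unique (HY p t)).
apply: powser_ext; last exact: powser_const.
by move=> n; rewrite c0 if_same.
Qed.

(** The determinant factor takes care of the t for which [Y t] is not known to be invertible, where
    [orbit_HR] gives nothing. *)
Lemma vanish_HR_flat (f : {mpoly RR[N * N]}) :
  (forall h, HR S h -> f.@[coords h] = 0) ->
  flat G (map_mpoly rtoc (f * \det (xmx RR N))).
Proof.
move=> f0 X LX k.
have real_case (Z : 'M[RR]_N) : lie G (map_mx rtoc Z) ->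
    taylor (map_mx rtoc Z) k (map_mpoly rtoc (f * \det (xmx RR N))) = 0.
  move=> LZ; rewrite /taylor /ev1 -map_iter_lderiv -(map_mx1 rtoc) meval_map.
  rewrite -[X in rtoc X]/(taylor Z k (f * \det (xmx RR N))).
  have [Y HY] := exists_orbit Z.
  have : ocoef Z (f * \det (xmx RR N)) k = 0.
    apply: powser_eq0 => t.
    suff <- : (f * \det (xmx RR N)).@[coords (Y t)] = 0 by apply: HY.
    rewrite mevalM -det_map_mx eval_xmx.
    have [Yu|] := boolP (Y t \in unitmx).
      by rewrite f0 ?mul0r //; apply: orbit_HR HY t Yu.
    by rewrite unitmxE unitfE negbK => /eqP->; rewrite mulr0.
  move/eqP; rewrite /ocoef mulf_eq0 invr_eq0 pnatr_eq0.
  rewrite -[_`! == _]negbK -lt0n fact_gt0 orbF.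
  by move/eqP->; rewrite rmorph0.
have [Z1 [Z2 [L1 L2 [i ->]]]] := lie_decomp LX.
have [q Hq] := taylor_line (map_mx rtoc Z1) (map_mx rtoc Z2) k
  (map_mpoly rtoc (f * \det (xmx RR N))).
(* For natural s the direction [Z1] + s [Z2] is real, so [q] vanishes at all naturals; being a
   polynomial it also vanishes at the complex scalar [i]. *)
suff q0 : q = 0 by rewrite Hq q0 horner0.
apply/eqP; apply: contraT => /poly_nonroot[s].
have eZ : map_mx rtoc Z1 + s%:R *: map_mx rtoc Z2 = map_mx rtoc (Z1 + s%:R *: Z2).
  by rewrite map_mxD map_mxZ rmorph_nat.
have LZ := lie_line s%:R L1 L2; rewrite eZ in LZ.
by rewrite -Hq eZ (real_case _ LZ) eqxx.
Qed.

Hypothesis connG : zconnected G.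

Lemma HR_irreducible (f g : {mpoly RR[N * N]}) :
  (forall h, HR S h -> f.@[coords h] * g.@[coords h] = 0) ->
  (forall h, HR S h -> f.@[coords h] = 0) \/ (forall h, HR S h -> g.@[coords h] = 0).
Proof.
move=> fg0; have [G1 _ _] := grpG.
have Gu x : G x -> x \in unitmx by case.
have desc p : flat G (map_mpoly rtoc p) -> forall h, HR S h -> p.@[coords h] = 0.
  move=> /(flat_van grpG Gu connG) vp h /HR_HC Gh; apply: (fmorph_inj rtoc).
  by rewrite rmorph0 -meval_map; apply: vp.
have : flat G (map_mpoly rtoc (f * g * \det (xmx RR N))).
  by apply: vanish_HR_flat => h Hh; rewrite mevalM; apply: fg0.
(* The determinant is not flat: its value at the identity is 1. *)
rewrite rmorphM /= => /flat_prime[]; last first.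
  move=> /(_ 0 lie0 0%N); rewrite taylor0 /ev1 -(map_mx1 rtoc) meval_map.
  by rewrite -det_map_mx eval_xmx det1 rmorph1 => /eqP; rewrite oner_eq0.
by rewrite rmorphM /= => /flat_prime[/desc|/desc]; [left|right].
Qed.

End RealPoints.

(** * Generic ranks for an irreducible family of matrices *)

Lemma max_ex (T : Type) (Pr : T -> Prop) (q : T -> nat) b :
  (exists x, Pr x) -> (forall x, Pr x -> (q x <= b)%N) ->
  exists2 x, Pr x & forall y, Pr y -> (q y <= q x)%N.
Proof.
move=> [x0 P0] qb.
have [|m [x Px qx] mmin] := @min_ex (fun m => exists2 x, Pr x & (q x + m = b)%N).
  by exists (b - q x0)%N, x0; rewrite // subnKC // qb.
exists x => // y Py; rewrite leqNgt; apply/negP => lt_xy.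
have le_yb := qb y Py; have lt : (b - q y < m)%N by lia.
by apply: (mmin _ lt); exists y => //; rewrite subnKC.
Qed.

Section GenericRank.

Variables (F : fieldType) (n : nat) (T : Type) (H : T -> Prop).
Variables (M : T -> 'M[F]_n) (B : 'M[F]_n).
Implicit Types (U V : 'M[F]_n) (g h : T).

(** In the application [B] is [W^T] and [U] is [W' *m Q], so this is the dimension of the projection
    of [W'] to the translate of [W] by [h]. *)
Definition rk h U : nat := \rank (U *m M h *m B).

Hypothesis n_gt0 : (0 < n)%N.
Hypothesis H_ne : exists h, H h.
Hypothesis H_mul : forall g h, H g -> H h -> exists2 h', H h' & M h' = M g *m M h.
Hypothesis H_inv : forall g, H g -> exists2 g', H g' & M g *m M g' = 1%:M.
Hypothesis H_irr : forall U, (forall g, H g -> (U *m M g <= U)%MS) ->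
  \rank U = 0%N \/ \rank U = n.
Hypothesis H_gen : forall U1 U2 h1 h2, H h1 -> H h2 ->
  exists h, [/\ H h, (rk h1 U1 <= rk h U1)%N & (rk h2 U2 <= rk h U2)%N].

Lemma gr_ex U : exists r, (exists2 h, H h & rk h U = r) /\
  (forall h, H h -> (rk h U <= r)%N).
Proof.
have [|h Hh hmax] := @max_ex T H (fun h => rk h U) n H_ne.
  by move=> h _; apply: rank_leq_row.
by exists (rk h U); split=> //; exists h.
Qed.

Definition gr U : nat := proj1_sig (constructive_indefinite_description _ (gr_ex U)).

Lemma gr_le U h : H h -> (rk h U <= gr U)%N.
Proof.
by rewrite /gr; case: constructive_indefinite_description => r /= [_]; apply.
Qed.

Lemma gr_att U : exists2 h, H h & rk h U = gr U.
Proof. by rewrite /gr; case: constructive_indefinite_description => r /= []. Qed.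

Lemma gr_leq_n U : (gr U <= n)%N.
Proof. by have [h _ <-] := gr_att U; apply: rank_leq_row. Qed.

Lemma M_unit g : H g -> M g \in unitmx.
Proof. by move=> /H_inv[g' _] /mulmx1_unit[]. Qed.

Lemma rankM U g : H g -> \rank (U *m M g) = \rank U.
Proof. by move=> Hg; rewrite mxrankMfree // row_free_unit M_unit. Qed.

Lemma rk_submod h U V :
  (rk h (U + V)%MS + rk h (U :&: V)%MS <= rk h U + rk h V)%N.
Proof.
rewrite /rk -!mulmxA; set C := M h *m B.
rewrite -(mxrank_sum_cap (U *m C) (V *m C)); apply: leq_add.
  by rewrite addsmxMr.
by apply: mxrankS; rewrite sub_capmx !submxMr ?capmxSl ?capmxSr.
Qed.

(** By [H_gen] the two maxima on the left are attained at a common h, where submodularity of [rk h]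
    applies. *)
Lemma gr_submod U V : (gr (U + V)%MS + gr (U :&: V)%MS <= gr U + gr V)%N.
Proof.
have [h1 H1 <-] := gr_att (U + V)%MS; have [h2 H2 <-] := gr_att (U :&: V)%MS.
have [h [Hh le1 le2]] := H_gen (U + V)%MS (U :&: V)%MS H1 H2.
apply: leq_trans (leq_add le1 le2) _; apply: leq_trans (rk_submod _ _ _) _.
by apply: leq_add; apply: gr_le.
Qed.

Lemma gr_inv U g : H g -> gr (U *m M g) = gr U.
Proof.
move=> Hg; apply/eqP; rewrite eqn_leq; apply/andP; split.
  have [h Hh <-] := gr_att (U *m M g); have [h' Hh' eqM] := H_mul Hg Hh.
  by apply: leq_trans (gr_le U Hh'); rewrite /rk eqM mulmxA.
have [h Hh <-] := gr_att U; have [g' Hg' gK] := H_inv Hg.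
have [h' Hh' eqM] := H_mul Hg' Hh.
apply: leq_trans (gr_le _ Hh'); rewrite /rk eqM mulmxA -(mulmxA U (M g)) gK.
by rewrite mulmx1.
Qed.

Lemma gr_full : gr 1%:M = \rank B.
Proof.
have [h Hh <-] := gr_att 1%:M; rewrite /rk mul1mx.
by rewrite eqmxMfull // row_full_unit M_unit.
Qed.

Lemma gr_eqmx U V : (U :=: V)%MS -> gr U = gr V.
Proof.
move=> eqUV; have rkE h : rk h U = rk h V.
  by rewrite /rk -!mulmxA; rewrite (eqmxMr _ eqUV).
have [h Hh hU] := gr_att U; have [h' Hh' hV] := gr_att V.
by apply/eqP; rewrite eqn_leq -{1}hU rkE gr_le //= -hV -rkE gr_le.
Qed.

(* The largest subspace among those minimizing the submodular, invariant function
   [n * gr U - \rank B * \rank U] is invariant. *)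
Lemma gr_lower_bound U : (\rank B * \rank U <= n * gr U)%N.
Proof.
(* The function to be minimized with its sign changed, shifted by [n * n] so that the truncated
   subtraction is exact. *)
pose e V := (\rank B * \rank V + n * n - n * gr V)%N.
have le_gr V : (n * gr V <= n * n)%N by rewrite leq_mul2l gr_leq_n orbT.
have le_e V : (e V <= n * n + n * n)%N.
  rewrite (leq_trans (leq_subr _ _)) // leq_add2r.
  by rewrite leq_mul ?rank_leq_row.
(* As ranks are at most n, the weight [n.+1] makes this a lexicographic maximum: first of [e], then
   of the rank. *)
have [||X _ Xmax] := @max_ex 'M[F]_n (fun=> True)
    (fun V => n.+1 * e V + \rank V)%N (n.+1 * (n * n + n * n) + n)%N.
- by exists 0.
- by move=> V _; rewrite leq_add ?leq_mul ?rank_leq_row.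
have emax V : (e V <= e X)%N.
  rewrite leqNgt; apply/negP => lt_e; have := Xmax V I.
  have := rank_leq_row X; have : (n.+1 * (e X).+1 <= n.+1 * e V)%N by rewrite leq_mul.
  rewrite mulnS; lia.
have inv g : H g -> (X *m M g <= X)%MS.
  move=> Hg; set V := X *m M g.
  have eV : e V = e X by rewrite /e gr_inv // rankM.
  have esup : (e X + e V <= e (X + V)%MS + e (X :&: V)%MS)%N.
    have := gr_submod X V; have := mxrank_sum_cap X V.
    have := le_gr X; have := le_gr V; have := le_gr (X + V)%MS.
    have := le_gr (X :&: V)%MS; rewrite /e.
    move=> h1 h2 h3 h4 dimE /(leq_mul (leqnn n)); rewrite !mulnDr => sub.
    have : (\rank B * \rank (X + V)%MS + \rank B * \rank (X :&: V)%MS =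
            \rank B * \rank X + \rank B * \rank V)%N by rewrite -!mulnDr dimE.
    lia.
  have eXV : e (X + V)%MS = e X.
    have := emax (X + V)%MS; have := emax (X :&: V)%MS; lia.
  have := Xmax (X + V)%MS I; rewrite eXV leq_add2l => le_rk.
  have : (X + V <= X)%MS.
    by rewrite -(geq_leqif (mxrank_leqif_sup (addsmxSl X V))).
  by apply: submx_trans; apply: addsmxSr.
have eXn : e X = (n * n)%N.
  rewrite /e; have [X0|Xn] := H_irr inv.
    have -> : gr X = 0%N.
      have [h _ <-] := gr_att X; apply/eqP; rewrite -leqn0 -X0.
      by rewrite /rk -mulmxA mxrankM_maxl.
    by rewrite X0 !muln0 subn0.
  have -> : gr X = \rank B.
    rewrite -gr_full; apply: gr_eqmx; apply/eqmxP.
    by rewrite submx1 sub1mx /row_full Xn eqxx.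
  by rewrite Xn mulnC addKn.
by have := emax U; rewrite eXn /e; have := le_gr U; lia.
Qed.

Definition tight U : Prop := (\rank B * \rank U = n * gr U)%N.

Lemma tight_add_cap U V : tight U -> tight V ->
  tight (U + V)%MS /\ tight (U :&: V)%MS.
Proof.
rewrite /tight => tU tV.
have := gr_submod U V; have := mxrank_sum_cap U V => dimE.
move=> /(leq_mul (leqnn n)); rewrite !mulnDr -tU -tV => sub.
have : (\rank B * \rank (U + V)%MS + \rank B * \rank (U :&: V)%MS =
        \rank B * \rank U + \rank B * \rank V)%N by rewrite -!mulnDr dimE.
have := gr_lower_bound (U + V)%MS; have := gr_lower_bound (U :&: V)%MS.
lia.
Qed.

(** The vectors all of whose translates lie in [V] form an invariant subspace containing [U], hence
    everything. *)
Lemma translates_span U V : (0 < \rank U)%N ->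
  (forall g, H g -> (U *m M g <= V)%MS) -> \rank V = n.
Proof.
move=> U0 UV.
pose inside (v : 'rV[F]_n) := forall g, H g -> (v *m M g <= V)%MS.
have [||X HX] := @subspace_mx F n inside.
- by move=> g _; rewrite mul0mx sub0mx.
- move=> a u v Hu Hv g Hg; rewrite mulmxDl -scalemxAl.
  by rewrite addmx_sub ?scalemx_sub ?Hu ?Hv.
have subX Y : (forall g, H g -> (Y *m M g <= V)%MS) -> (Y <= X)%MS.
  move=> HY; apply/row_subP => i; apply/HX => g Hg.
  by rewrite -row_mul; apply: submx_trans (HY g Hg); apply: row_sub.
have XV g : H g -> (X *m M g <= V)%MS.
  move=> Hg; apply/row_subP => i; rewrite row_mul; apply: (proj2 (HX (row i X))) => //.
  exact: row_sub.
have [X0|Xn] : \rank X = 0%N \/ \rank X = n.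
- apply: H_irr => g Hg; apply: subX => g' Hg'; rewrite -mulmxA.
  by have [h Hh <-] := H_mul Hg Hg'; apply: XV.
- by have := mxrankS (subX _ _ UV); rewrite X0 leqNgt U0.
have [g Hg] := H_ne; apply/eqP; rewrite eqn_leq rank_leq_row /=.
by rewrite -{1}Xn -(rankM X Hg) mxrankS // XV.
Qed.

(* The complement is a sum of translates of a minimal tight subspace. *)
Lemma tight_complement U : tight U ->
  exists V, [/\ tight V, \rank (U + V)%MS = n & (\rank U + \rank V = n)%N].
Proof.
move=> tU.
have t1 : tight 1%:M by rewrite /tight gr_full mxrank1 mulnC.
have [a [A [tA A0 dA]] amin] :=
  @min_ex (fun a => exists A, [/\ tight A, (0 < \rank A)%N & \rank A = a])
  (ex_intro _ _ (ex_intro _ _ (And3 t1 (eq_ind_r (leq 1) n_gt0 (mxrank1 F n)) erefl))).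
have t0 : tight 0.
  have := gr_lower_bound 0; have [h _] := gr_att 0.
  by rewrite /rk !mul0mx mxrank0 /tight mxrank0 => <-; rewrite !muln0.
have [||V [tV capUV] Vmax] := @max_ex 'M[F]_n
   (fun V => tight V /\ \rank (U :&: V)%MS = 0%N) (fun V => \rank V) n.
- by exists 0; rewrite capmx0 mxrank0.
- by move=> V _; apply: rank_leq_row.
have dimUV := mxrank_sum_cap U V; rewrite capUV addn0 in dimUV.
suff full : \rank (U + V)%MS = n by exists V; split; rewrite // -dimUV.
have [tX _] := tight_add_cap tU tV; set X := (U + V)%MS in tX dimUV *.
(* Were [X] proper, some translate of [A] would not lie in it. By minimality of [A] that translate
   meets [X] trivially, so adding it to [V] contradicts the maximality of [V]. *)
apply: NNPP => notfull; apply: notfull; apply: (translates_span A0) => g Hg.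
apply/negPn/negP => notsub.
have tAg : tight (A *m M g) by rewrite /tight gr_inv // rankM.
have [_ tcap] := tight_add_cap tAg tX.
have cap0 : \rank (A *m M g :&: X)%MS = 0%N.
  apply/eqP/negPn/negP; rewrite -lt0n => cap0.
  have lt_a : (\rank (A *m M g :&: X)%MS < a)%N.
    rewrite -dA -(rankM A Hg) ltn_neqAle mxrankS ?capmxSl // andbT.
    apply: contra notsub => /eqP eq_rk; apply: submx_trans (capmxSr (A *m M g) X).
    by rewrite -(geq_leqif (mxrank_leqif_sup (capmxSl (A *m M g) X))) eq_rk.
  by apply: (amin _ lt_a); exists (A *m M g :&: X)%MS.
have [tVA _] := tight_add_cap tV tAg.
have dimXA := mxrank_sum_cap (A *m M g) X; rewrite cap0 addn0 rankM // in dimXA.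
have dimVA := mxrank_sum_cap V (A *m M g); rewrite rankM // in dimVA.
have dimUVA := mxrank_sum_cap U (V + A *m M g)%MS.
have eqsum : \rank (U + (V + A *m M g))%MS = \rank (A *m M g + X)%MS.
  by rewrite addsmxA addsmxC.
have capVA : \rank (V :&: A *m M g)%MS = 0%N.
  apply/eqP; rewrite -leqn0 -cap0 capmxC; apply/mxrankS/capmxS => //.
  exact: addsmxSr.
have le_V := Vmax (V + A *m M g)%MS.
rewrite eqsum in dimUVA; rewrite capVA addn0 in dimVA.
have /le_V : tight (V + A *m M g)%MS /\ \rank (U :&: (V + A *m M g))%MS = 0%N.
  by split=> //; lia.
by lia.
Qed.

(** For a tight complement [V], the two equalities add up to [gr U + gr V = \rank B], while the
    ranks at any h sum to at least [\rank B]. So neither can fall below its maximum. *)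
Lemma tight_rk U h : tight U -> H h -> rk h U = gr U.
Proof.
move=> tU Hh; have [V [tV full dims]] := tight_complement tU.
have leU := gr_le U Hh; have leV := gr_le V Hh.
have leB : (\rank B <= rk h U + rk h V)%N.
  apply: leq_trans (rk_submod h U V); apply: leq_trans (leq_addr _ _).
  rewrite /rk; have <- : \rank (1%:M *m M h *m B) = \rank B.
    by rewrite mul1mx eqmxMfull // row_full_unit M_unit.
  by rewrite -!mulmxA mxrankS // submxMr // submx_full // /row_full full.
apply/eqP; rewrite eqn_leq leU /= -(leq_pmul2l n_gt0) -tU.
have : (n * \rank B <= n * rk h U + n * gr V)%N.
  by rewrite -mulnDr leq_mul // (leq_trans leB) // leq_add2l.
have : (\rank B * \rank U + \rank B * \rank V = n * \rank B)%N.
  by rewrite -mulnDr dims mulnC.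
by rewrite -tV; lia.
Qed.

End GenericRank.

(** * Tuples in general position *)

Section Separation.

Variables (F : fieldType) (L : nat) (T : Type) (H : T -> Prop) (v : T -> 'rV[F]_L).

Definition vmx R (y : 'I_R -> T) : 'M[F]_(R, L) := \matrix_i v (y i).

Lemma basis_points : exists R (y : 'I_R -> T),
  [/\ (R <= L)%N, forall i, H (y i), row_free (vmx y) &
      forall h, H h -> (v h <= vmx y)%MS].
Proof.
pose good R := exists2 y : 'I_R -> T, forall i, H (y i) & row_free (vmx y).
have good_le R : good R -> (R <= L)%N.
  by move=> [y _ /eqP <-]; apply: rank_leq_col.
have [||R [y Hy yfree] Rmax] := @max_ex nat good id L.
- have no (i : 'I_0) : False by case: i.
  exists 0%N; exists (fun i => False_rect T (no i)); first by move=> i; case: (no i).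
  by rewrite /row_free [vmx _]flatmx0 mxrank0.
- exact: good_le.
exists R, y; split=> //; first by apply: good_le; exists y.
move=> h Hh; apply/negPn/negP => nsub.
suff /Rmax : good R.+1 by rewrite ltnn.
pose y' (i : 'I_R.+1) := if unlift ord0 i is Some j then y j else h.
exists y' => [i|]; first by rewrite /y'; case: (unlift _ _).
have sub : (vmx y + v h <= vmx y')%MS.
  rewrite addsmx_sub; apply/andP; split.
    apply/row_subP => i; rewrite rowK.
    have -> : v (y i) = row (lift ord0 i) (vmx y') by rewrite rowK /y' liftK.
    exact: row_sub.
  have -> : v h = row ord0 (vmx y') by rewrite rowK /y' unlift_none.
  exact: row_sub.
rewrite /row_free eqn_leq rank_leq_row /=; apply: leq_trans (mxrankS sub).
move/eqP: yfree => {1}<-; apply: rank_ltmx; rewrite /ltmx addsmxSl /=.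
apply: contra nsub => sub'; apply: submx_trans sub'; exact: addsmxSr.
Qed.

Variables (R : nat) (y : 'I_R -> T).
Hypothesis y_free : row_free (vmx y).
Hypothesis y_span : forall h, H h -> (v h <= vmx y)%MS.

(** The determinant of the coordinates of the [v (x i)] in the basis [v (y j)]. If it is nonzero,
    the [v (x i)] form another basis, and a linear functional killing them kills every [v h]. *)
Definition sepdet (x : 'I_R -> T) : F := \det (vmx x *m pinvmx (vmx y)).

Lemma sepdet_base : sepdet y = 1.
Proof. by rewrite /sepdet mulmxVp // det1. Qed.

Lemma sepdet_separates (x : 'I_R -> T) (c : 'cV[F]_L) :
  (forall i, H (x i)) -> sepdet x != 0 -> (forall i, v (x i) *m c = 0) ->
  forall h, H h -> v h *m c = 0.
Proof.
move=> Hx det0 xc h Hh.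
have sub : (vmx x <= vmx y)%MS.
  by apply/row_subP => i; rewrite rowK; apply: y_span.
have full : (R <= \rank (vmx x))%N.
  apply: leq_trans (mxrankM_maxl _ (pinvmx (vmx y))).
  by rewrite mxrank_unit // unitmxE unitfE.
have sub' : (vmx y <= vmx x)%MS.
  rewrite -(geq_leqif (mxrank_leqif_sup sub)).
  by rewrite (eqP y_free).
have /submxP[D ->] := submx_trans (y_span Hh) sub'.
rewrite -mulmxA; suff -> : vmx x *m c = 0 by rewrite mulmx0.
by apply/row_matrixP => i; rewrite row_mul rowK xc row0.
Qed.

End Separation.

Lemma rank_geP (F : fieldType) n (X : 'M[F]_n) r : (r <= \rank X)%N ->
  exists (A : 'M[F]_(r, n)) (B : 'M[F]_(n, r)), A *m X *m B = 1%:M.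
Proof.
move=> le_r; have le_n : (r <= n)%N := leq_trans le_r (rank_leq_row X).
exists (pid_mx r *m invmx (col_ebase X)), (invmx (row_ebase X) *m pid_mx r).
rewrite -{2}(mulmx_ebase X) -!mulmxA mulKmx ?col_ebase_unit //.
rewrite mulKVmx ?row_ebase_unit // !mul_pid_mx.
by rewrite (minn_idPr le_r) (minn_idPr le_n) minnn (minn_idPr le_n) pid_mx_1.
Qed.

Section Monomials.

Variables (F : fieldType) (n r : nat).
Local Notation idx := {ffun 'I_r -> 'I_n * 'I_n}.

(** Monomials are indexed by ordered sequences of r positions, so the same monomial may occur
    several times; this makes the expansion of a determinant direct. *)
Definition monov (P : 'M[F]_n) : 'rV[F]_#|{: idx}| :=
  \row_a \prod_i P ((enum_val a : idx) i).1 ((enum_val a : idx) i).2.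

Lemma card_idx : #|{: idx}| = ((n * n) ^ r)%N.
Proof. by rewrite card_ffun card_prod !card_ord. Qed.

Lemma det_monov (A : 'M[F]_(r, n)) (B : 'M[F]_(n, r)) :
  exists c : 'cV[F]_#|{: idx}|, forall P : 'M[F]_n,
    \det (A *m P *m B) = (monov P *m c) 0 0.
Proof.
pose co (a : idx) : F := \sum_(s : 'S_r) (-1) ^+ s *
  \prod_i (A i (a i).1 * B (a i).2 (s i)).
exists (\col_a co (enum_val a)) => P.
transitivity (\sum_(a : idx) (\prod_i P (a i).1 (a i).2) * co a); last first.
  rewrite mxE; under [RHS]eq_bigr => a _ do rewrite !mxE.
  rewrite -(big_enum_val (fun a : idx => (\prod_i P (a i).1 (a i).2) * co a)).
  by apply: eq_bigl => a; rewrite inE.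
rewrite /co; under [RHS]eq_bigr => a _ do rewrite mulr_sumr.
rewrite exchange_big /determinant; apply: eq_bigr => s _ /=.
under [RHS]eq_bigr => a _ do rewrite mulrCA -big_split /=.
rewrite -mulr_sumr; congr (_ * _).
rewrite -(bigA_distr_bigA (fun i p => P p.1 p.2 * (A i p.1 * B p.2 (s i)))).
apply: eq_bigr => i _; rewrite mxE -(pair_big xpredT xpredT
  (fun p q => P p q * (A i p * B q (s i)))) /= exchange_big.
apply: eq_bigr => q _ /=; rewrite mxE mulr_suml; apply: eq_bigr => p _.
by ring.
Qed.

End Monomials.

Section GeneralPosition.

Variables (F : fieldType) (n : nat) (T : Type) (H : T -> Prop) (P : T -> 'M[F]_n).

(** A minor that is 1 at [x] is a linear functional of the monomials and vanishes at every bad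
    index. With [R] bad indices, separation would make it vanish at [x] as well. The subspace [U]
    enters only through the functional. *)
Lemma few_low_rank r R (y : 'I_R -> T) m (h : 'I_m -> T) (U B : 'M[F]_n) x :
  (forall z, H z -> (monov r (P z) <= vmx (fun t => monov r (P t)) y)%MS) ->
  row_free (vmx (fun t => monov r (P t)) y) ->
  (forall j, H (h j)) ->
  (forall J : {ffun 'I_R -> 'I_m}, injectiveb J ->
    sepdet (fun t => monov r (P t)) y (h \o J) != 0) ->
  H x -> (r <= \rank (U *m P x *m B))%N ->
  (#|[pred j | \rank (U *m P (h j) *m B) < r]| < R)%N.
Proof.
move=> yspan yfree Hh sep Hx le_r; rewrite ltnNge; apply/negP => leR.
have [A1 [B1 AB1]] := rank_geP le_r.
have [c Hc] := det_monov (A1 *m U) (B *m B1).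
pose J : {ffun 'I_R -> 'I_m} := [ffun i => enum_val (widen_ord leR i)].
have Jinj : injectiveb J.
  apply/injectiveP => i j; rewrite !ffunE => /enum_val_inj/(congr1 val) /= ij.
  exact: val_inj.
have Jbad i : (\rank (U *m P (h (J i)) *m B) < r)%N.
  by have := enum_valP (widen_ord leR i); rewrite inE /J ffunE.
have vc0 i : monov r (P ((h \o J) i)) *m c = 0.
  apply/matrixP => a b; rewrite !ord1 -Hc [RHS]mxE; apply/eqP.
  apply: contraTT (Jbad i); rewrite -unitfE -unitmxE -leqNgt => /mxrank_unit <-.
  rewrite -!mulmxA; apply: leq_trans (mxrankM_maxr _ _) _.
  by rewrite !mulmxA mxrankM_maxl.
have := sepdet_separates yfree yspan (fun i => Hh (J i)) (sep J Jinj) vc0 Hx.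
move=> /matrixP/(_ 0 0); rewrite -Hc !mulmxA.
have -> : A1 *m U *m P x *m B *m B1 = 1%:M by rewrite -AB1 !mulmxA.
by rewrite det1 mxE => /eqP; rewrite oner_eq0.
Qed.

End GeneralPosition.

(** * Regular functions on powers of the group *)

Section Powers.

Variables (N m : nat).
Implicit Types (h : 'I_m -> 'M[RR]_N).

Definition regular (phi : ('I_m -> 'M[RR]_N) -> RR) : Prop :=
  exists q : {mpoly RR[m * (N * N)]}, forall h, phi h = q.@[coordsRm h].

Lemma coordsRm_index h j l : coordsRm h (mxvec_index j l) = coords (h j) l.
Proof. by rewrite /coordsRm mxvecE mxE. Qed.

Lemma coordsRm_ext h h' : h =1 h' -> coordsRm h =1 coordsRm h'.
Proof.
by move=> eq_h i; case/mxvec_indexP: i => j l; rewrite !coordsRm_index eq_h.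
Qed.

Lemma regular_const c : regular (fun=> c).
Proof. by exists c%:MP => h; rewrite mevalC. Qed.

Lemma regularM phi psi : regular phi -> regular psi -> regular (fun h => phi h * psi h).
Proof. by move=> [p Hp] [q Hq]; exists (p * q) => h; rewrite mevalM Hp Hq. Qed.

Lemma regular_sum (I : finType) (phi : I -> ('I_m -> 'M[RR]_N) -> RR) :
  (forall i, regular (phi i)) -> regular (fun h => \sum_i phi i h).
Proof.
move=> /fin_all_exists[q Hq]; exists (\sum_i q i) => h.
by rewrite raddf_sum; apply: eq_bigr => i _; rewrite Hq.
Qed.

Lemma regular_prod (I : finType) (phi : I -> ('I_m -> 'M[RR]_N) -> RR) :
  (forall i, regular (phi i)) -> regular (fun h => \prod_i phi i h).
Proof.
move=> /fin_all_exists[q Hq]; exists (\prod_i q i) => h.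
by rewrite rmorph_prod; apply: eq_bigr => i _; rewrite Hq.
Qed.

Lemma regular_det r (X : ('I_m -> 'M[RR]_N) -> 'M[RR]_r) :
  (forall i j, regular (fun h => X h i j)) -> regular (fun h => \det (X h)).
Proof.
move=> regX; apply: regular_sum => s; apply: regularM; first exact: regular_const.
exact: regular_prod.
Qed.

Lemma regular_coord (p : {mpoly RR[N * N]}) j : regular (fun h => p.@[coordsR (h j)]).
Proof.
exists (mmap (@mpolyC _ _) (fun l => 'X_(mxvec_index j l)) p) => h.
elim/mpoly_ind_ring: p => [c|l|p q IHp IHq|p q IHp IHq].
- by rewrite mmapC !mevalC.
- by rewrite mmapX mmap1U !mevalXU coordsRm_index.
- by rewrite [mmap _ _ _]rmorphD /= !mevalD IHp IHq.
- by rewrite [mmap _ _ _]rmorphM /= !mevalM IHp IHq.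
Qed.

Definition upd h j x : 'I_m -> 'M[RR]_N := fun j' => if j' == j then x else h j'.

Lemma partial_eval (q : {mpoly RR[m * (N * N)]}) h j :
  exists p : {mpoly RR[N * N]}, forall x, p.@[coords x] = q.@[coordsRm (upd h j x)].
Proof.
pose z : 'I_(m * (N * N)) -> {mpoly RR[N * N]} := fun i =>
  mxvec (\matrix_(j' < m, l < N * N) if j' == j then 'X_l else (coords (h j') l)%:MP) 0 i.
exists (mmap (@mpolyC _ _) z q) => x.
elim/mpoly_ind_ring: q => [c|i|p q IHp IHq|p q IHp IHq].
- by rewrite mmapC !mevalC.
- rewrite mmapX mmap1U mevalXU /z; case/mxvec_indexP: i => j' l.
  rewrite coordsRm_index mxvecE mxE /upd; case: ifP => _; first by rewrite mevalXU.
  by rewrite mevalC.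
- by rewrite [mmap _ _ _]rmorphD /= !mevalD IHp IHq.
- by rewrite [mmap _ _ _]rmorphM /= !mevalM IHp IHq.
Qed.

Variable H : 'M[RR]_N -> Prop.
Hypothesis H_irred : forall f g : {mpoly RR[N * N]},
  (forall x, H x -> f.@[coords x] * g.@[coords x] = 0) ->
  (forall x, H x -> f.@[coords x] = 0) \/ (forall x, H x -> g.@[coords x] = 0).

Lemma H_common (f g : {mpoly RR[N * N]}) x y :
  H x -> H y -> f.@[coords x] != 0 -> g.@[coords y] != 0 ->
  exists z, [/\ H z, f.@[coords z] != 0 & g.@[coords z] != 0].
Proof.
move=> Hx Hy fx gy; apply: NNPP => none.
have [|f0|g0] := @H_irred f g.
- move=> z Hz; apply/eqP; rewrite mulf_eq0 -[_ || _]negbK negb_or.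
  by apply/negP => /andP[fz gz]; apply: none; exists z.
- by rewrite f0 ?eqxx in fx.
- by rewrite g0 ?eqxx in gy.
Qed.

(* The two points are made equal one coordinate at a time. *)
Lemma Hm_common phi psi h h' : regular phi -> regular psi ->
  (forall j, H (h j)) -> (forall j, H (h' j)) -> phi h != 0 -> psi h' != 0 ->
  exists z, [/\ forall j, H (z j), phi z != 0 & psi z != 0].
Proof.
move=> [p Hp] [q Hq] Hh Hh' ph qh'.
have step (i : nat) : (i <= m)%N -> exists z z', [/\ forall j, H (z j),
    forall j, H (z' j), p.@[coordsRm z] != 0, q.@[coordsRm z'] != 0 &
    forall j : 'I_m, (j < i)%N -> z j = z' j].
  elim: i => [_|i IHi lt_im]; first by exists h, h'; rewrite -Hp -Hq.
  have [z [z' [Hz Hz' pz qz' eqz]]] := IHi (ltnW lt_im).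
  pose j := Ordinal lt_im.
  have [p1 Hp1] := partial_eval p z j; have [q1 Hq1] := partial_eval q z' j.
  have updE w : coordsRm (upd w j (w j)) =1 coordsRm w.
    by apply: coordsRm_ext => j'; rewrite /upd; case: eqP => [->|].
  have [|| x [Hx px qx]] := @H_common p1 q1 _ _ (Hz j) (Hz' j).
  - by rewrite Hp1 (meval_eq _ (updE z)).
  - by rewrite Hq1 (meval_eq _ (updE z')).
  exists (upd z j x), (upd z' j x); split.
  - by move=> j'; rewrite /upd; case: ifP.
  - by move=> j'; rewrite /upd; case: ifP.
  - by rewrite -Hp1.
  - by rewrite -Hq1.
  - move=> j'; rewrite ltnS leq_eqVlt /upd; case: (j' =P j) => // ne.
    case/predU1P => [eq_i|]; last exact: eqz.
    by case: ne; apply: val_inj.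
have [z [z' [Hz Hz' pz qz' eqz]]] := step m (leqnn m).
exists z; split=> //; rewrite ?Hp ?Hq //.
by rewrite (meval_eq _ (coordsRm_ext (fun j => eqz j (ltn_ord j)))).
Qed.

Lemma Hm_common_all (I : finType) (phi : I -> ('I_m -> 'M[RR]_N) -> RR) :
  (exists x, H x) -> (forall i, regular (phi i)) ->
  (forall i, exists2 h, forall j, H (h j) & phi i h != 0) ->
  exists2 h, forall j, H (h j) & \prod_i phi i h != 0.
Proof.
move=> [x Hx] reg nz.
have [h [Hh ph]] : exists h, (forall j, H (h j)) /\ forall i, i \in enum I -> phi i h != 0.
  elim: (enum I) => [|a s [h [Hh ph]]]; first by exists (fun=> x).
  have [h' Hh' pa] := nz a.
  pose psi h := \prod_i if i \in s then phi i h else 1.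
  have regpsi : regular psi.
    by apply: regular_prod => i; case: (i \in s) => //; apply: regular_const.
  have psih : psi h != 0.
    by apply/prodf_neq0 => i _; case: ifP => [/ph|_] //; rewrite oner_eq0.
  have [z [Hz az /prodf_neq0 sz]] := Hm_common (reg a) regpsi Hh' Hh pa psih.
  exists z; split=> // i; rewrite inE => /predU1P[->//|si].
  by have := sz i isT; rewrite si.
by exists h => //; apply/prodf_neq0 => i _; apply: ph; rewrite mem_enum.
Qed.

End Powers.

(** * Projections as pairings *)

Section Projection.

Variables (K : realFieldType) (n : nat) (Q : 'M[K]_n).
Hypothesis Qpos : forall v : 'rV[K]_n, v != 0 -> 0 < (v *m Q *m v^T) 0 0.

Lemma posdef_gram_unit p (X : 'M[K]_(p, n)) : row_free X -> X *m Q *m X^T \in unitmx.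
Proof.
move=> Xfree; rewrite -row_free_unit; apply: inj_row_free => v vX.
have [//|vn0] := eqVneq v 0.
have /Qpos : v *m X != 0 by rewrite mulmx_free_eq0.
rewrite trmx_mul !mulmxA -(mulmxA v X) -(mulmxA v) vX.
by rewrite mul0mx mxE ltxx.
Qed.

Lemma posdef_unit : Q \in unitmx.
Proof.
have := @posdef_gram_unit n 1%:M; rewrite mul1mx trmx1 mulmx1; apply.
by rewrite row_free_unit unitmx1.
Qed.

(** The inverse Gram matrix, [X] and [(col_base U)^T] are all row free, so multiplying by them on
    the right preserves the rank; both sides reduce to the rank of [W' *m Q *m X^T]. *)
Lemma rank_projection (U W' : 'M[K]_n) (X := row_base U) :
  \rank (W' *m (Q *m X^T *m invmx (X *m Q *m X^T) *m X)) = \rank (W' *m Q *m U^T).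
Proof.
have Xfree : row_free X := row_base_free U.
have Gfree : row_free (invmx (X *m Q *m X^T)).
  by rewrite row_free_unit unitmx_inv posdef_gram_unit.
have Ufree : row_free (col_base U)^T.
  by rewrite /row_free mxrank_tr -/(row_full _) col_base_full.
have -> : U^T = X^T *m (col_base U)^T by rewrite -trmx_mul mulmx_base.
(* otherwise [mulmxA] unfolds [row_base] *)
clearbody X.
rewrite !mulmxA (mxrankMfree _ Xfree) (mxrankMfree _ Gfree).
by rewrite (mxrankMfree _ Ufree).
Qed.

End Projection.

Lemma dim_projE n (Q U W' : 'M[RR]_n) : inner_product Q ->
  dim_proj Q U W' = \rank (W' *m Q *m U^T).
Proof. by move=> [_ Qpos]; apply: (rank_projection Qpos). Qed.

(** * The regular representation on real points *)

Section RealRep.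

Variables (N n : nat) (S : {mpoly RR[N * N]} -> Prop) (k0 : nat).
Variable P : 'I_n -> 'I_n -> {mpoly RR[N * N]}.
Hypothesis grpG : is_subgroup (HC S).
Hypothesis rep : regular_rep S k0 P.

(** The representation with the power of the determinant cleared: the entries become polynomial, and
    ranks are unchanged on the group. *)
Definition nummx (h : 'M[RR]_N) : 'M[RR]_n := \matrix_(i, j) (P i j).@[coordsR h].

Lemma rhoRE h : rhoR k0 P h = (\det h) ^- k0 *: nummx h.
Proof. by apply/matrixP => i j; rewrite !mxE mulrC. Qed.

Lemma rhoC_map h : rhoC k0 P (map_mx rtoc h) = map_mx rtoc (rhoR k0 P h).
Proof.
apply/matrixP => i j; rewrite !mxE rmorphM fmorphV rmorphXn det_map_mx.
by congr (_ * _); apply: (meval_map rtoc).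
Qed.

Lemma HR_of_HC h : HC S (map_mx rtoc h) -> HR S h.
Proof.
move=> [hu hS]; split=> [|p Sp]; first by rewrite map_unitmx in hu.
apply: (fmorph_inj rtoc); rewrite rmorph0 -(hS p Sp).
exact/esym/(meval_map rtoc).
Qed.

Lemma HR1 : HR S 1%:M.
Proof. by apply: HR_of_HC; rewrite map_mx1; case: grpG. Qed.

Lemma HR_mul g h : HR S g -> HR S h -> HR S (g *m h).
Proof.
move=> /HR_HC Hg /HR_HC Hh; apply: HR_of_HC; rewrite map_mxM.
by case: grpG => _ GM _; apply: GM.
Qed.

Lemma HR_inv g : HR S g -> HR S (invmx g).
Proof.
move=> /HR_HC Hg; apply: HR_of_HC; rewrite map_invmx.
by case: grpG => _ _ GV; apply: GV.
Qed.

Lemma rhoR_mul g h : HR S g -> HR S h ->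
  rhoR k0 P (g *m h) = rhoR k0 P g *m rhoR k0 P h.
Proof.
move=> /HR_HC Hg /HR_HC Hh; apply: (map_mx_inj (f := rtoc)).
by rewrite map_mxM -!rhoC_map map_mxM; apply: (proj2 rep).
Qed.

Lemma rhoR1 : rhoR k0 P 1%:M = 1%:M.
Proof.
apply: (map_mx_inj (f := rtoc)); rewrite -rhoC_map !map_mx1.
exact: (proj1 rep).
Qed.

Lemma rk_nummx (B U : 'M[RR]_n) h : HR S h ->
  rk (rhoR k0 P) B h U = \rank (U *m nummx h *m B).
Proof.
move=> [hu _]; rewrite /rk rhoRE -scalemxAr -scalemxAl.
have det0 : (\det h) ^- k0 != 0 by rewrite invr_eq0 expf_neq0 // -unitfE -unitmxE.
by rewrite (eqmx_scale _ det0).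
Qed.

(** The action on subspaces uses the transpose of [rhoR k0 P g]. If [U] is stable under
    [rhoR k0 P g] itself, its annihilator [kermx U^T] is a subrepresentation. *)
Lemma dual_irreducible : irreducible_rep (HR S) (rhoR k0 P) ->
  forall U : 'M[RR]_n, (forall g, HR S g -> (U *m rhoR k0 P g <= U)%MS) ->
  \rank U = 0%N \/ \rank U = n.
Proof.
move=> [_ irr] U invU.
have rkK : \rank (kermx U^T) = (n - \rank U)%N by rewrite mxrank_ker mxrank_tr.
have le_U := rank_leq_row U.
have [g Hg|K0|K1] := irr (kermx U^T).
- apply/sub_kermxP; have /submxP[D eqD] := invU g Hg.
  by rewrite /act -mulmxA -trmx_mul eqD trmx_mul mulmxA mulmx_ker mul0mx.
- by right; move: rkK; rewrite (eqmxP K0) mxrank0; lia.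
- by left; move: rkK; rewrite (eqmxP K1) mxrank1; lia.
Qed.

Definition numdet r (A : 'M[RR]_(r, n)) (B : 'M[RR]_(n, r)) : {mpoly RR[N * N]} :=
  \det (map_mx (@mpolyC _ RR) A *m (\matrix_(i, j) P i j) *m map_mx (@mpolyC _ RR) B).

Lemma numdet_eval r (A : 'M[RR]_(r, n)) (B : 'M[RR]_(n, r)) h :
  (numdet A B).@[coords h] = \det (A *m nummx h *m B).
Proof.
rewrite /numdet -det_map_mx !map_mxM; congr (\det (_ *m _ *m _)).
- by apply/matrixP => i j; rewrite !mxE /= mevalC.
- by apply/matrixP => i j; rewrite !mxE.
- by apply/matrixP => i j; rewrite !mxE /= mevalC.
Qed.

Hypothesis connG : zconnected (HC S).

(** Each rank bound is forced by the nonvanishing of one polynomial, a generalized minor; on an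
    irreducible set two such conditions hold at a common point. *)
Lemma rk_common (B U1 U2 : 'M[RR]_n) h1 h2 : HR S h1 -> HR S h2 ->
  exists h, [/\ HR S h, (rk (rhoR k0 P) B h1 U1 <= rk (rhoR k0 P) B h U1)%N
                      & (rk (rhoR k0 P) B h2 U2 <= rk (rhoR k0 P) B h U2)%N].
Proof.
move=> H1 H2.
have witness U x : HR S x -> exists2 p : {mpoly RR[N * N]}, p.@[coords x] != 0 &
    forall z, HR S z -> p.@[coords z] != 0 ->
      (rk (rhoR k0 P) B x U <= rk (rhoR k0 P) B z U)%N.
  move=> Hx; rewrite (rk_nummx _ _ Hx).
  have [r eq_r] : exists r, r = \rank (U *m nummx x *m B) by eexists.
  have le_r : (r <= \rank (U *m nummx x *m B))%N by rewrite eq_r.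
  rewrite -eq_r; have [A1 [B1 AB1]] := rank_geP le_r.
  exists (numdet (A1 *m U) (B *m B1)) => [|z Hz].
    by rewrite numdet_eval !mulmxA; move: AB1; rewrite !mulmxA => ->; rewrite det1 oner_eq0.
  rewrite numdet_eval -unitfE -unitmxE => /mxrank_unit eq_rk.
  rewrite (rk_nummx _ _ Hz) -[X in (X <= _)%N]eq_rk -!mulmxA.
  apply: leq_trans (mxrankM_maxr _ _) _.
  by rewrite !mulmxA mxrankM_maxl.
have [p1 p1x Hp1] := witness U1 _ H1; have [p2 p2x Hp2] := witness U2 _ H2.
have [z [Hz z1 z2]] := H_common (HR_irreducible grpG connG) H1 H2 p1x p2x.
by exists z; split=> //; [apply: Hp1|apply: Hp2].
Qed.

End RealRep.

(** * The generic open set and the final count *)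

Lemma sepdet_ext (F : fieldType) L (T : Type) (v : T -> 'rV[F]_L) R (y x x' : 'I_R -> T) :
  x =1 x' -> sepdet v y x = sepdet v y x'.
Proof.
move=> eq_x; congr (\det (_ *m _)); apply/matrixP => i j.
by rewrite !mxE eq_x.
Qed.

Lemma regular_sepdet N m n (P : 'I_n -> 'I_n -> {mpoly RR[N * N]}) r R
    (y : 'I_R -> 'M[RR]_N) (J : 'I_R -> 'I_m) :
  regular (fun h => sepdet (fun t => monov r (nummx P t)) y (h \o J)).
Proof.
apply: regular_det => i j.
suff [q Hq] : regular (fun h : 'I_m -> 'M[RR]_N => \sum_l monov r (nummx P (h (J i))) 0 l *
    pinvmx (vmx (fun t => monov r (nummx P t)) y) l j).
  by exists q => h; rewrite -Hq mxE; apply: eq_bigr => l _; rewrite mxE.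
apply: regular_sum => l; apply: regularM; last exact: regular_const.
suff [q Hq] : regular (fun h : 'I_m -> 'M[RR]_N => \prod_i0
    (P ((enum_val l : {ffun 'I_r -> 'I_n * 'I_n}) i0).1 (enum_val l i0).2).@[coordsR (h (J i))]).
  by exists q => h; rewrite -Hq mxE; apply: eq_bigr => a _; rewrite mxE.
by apply: regular_prod => a; apply: regular_coord.
Qed.

Lemma sum_low_rank m (f : 'I_m -> nat) r L :
  (#|[pred j | (f j < r)%N]| <= L)%N -> (m * r <= \sum_j f j + L * r)%N.
Proof.
move=> le_L.
apply: leq_trans (_ : (\sum_j f j + \sum_(j | (f j < r)%N) r <= _)%N); last first.
  by rewrite sum_nat_const leq_add2l leq_mul2r; apply/orP; right.
have -> : (m * r = \sum_(j < m) r)%N by rewrite sum_nat_const card_ord.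
rewrite [X in (_ <= _ + X)%N]big_mkcond -big_split /=.
by apply: leq_sum => j _; case: ltnP => le_r; rewrite ?leq_addl ?addn0.
Qed.

Theorem theorem8p1 :
  exists C : nat -> nat -> nat,
  forall (N : nat) (S : {mpoly RR[N * N]} -> Prop),
    is_subgroup (HC S) -> zconnected (HC S) -> semisimple (HC S) ->
  forall (n k0 : nat) (P : 'I_n -> 'I_n -> {mpoly RR[N * N]}),
    regular_rep S k0 P ->
    nontrivial_rep (HR S) (rhoR k0 P) ->
    irreducible_rep (HR S) (rhoR k0 P) ->
  forall Q : 'M[RR]_n, inner_product Q ->
  forall (k : nat) (W : 'M[RR]_n), \rank W = k ->
  exists m : nat, (0 < m <= C n k)%N /\
  exists O : ('I_m -> 'M[RR]_N) -> Prop, zopen_dense_Hm S O /\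
  forall h : 'I_m -> 'M[RR]_N, O h -> forall W' : 'M[RR]_n,
    (m * k)%:R / n%:R * (\rank W')%:R
      <= ((\sum_(j < m) dim_proj Q (act (rhoR k0 P) (h j) W) W')%N)%:R :> RR.
Proof.
(* The first factor [L] bounds the number of monomials of any degree r up to n, and thereby the
   number of bad indices. The factor [n * n] absorbs n times the loss, at most n, at each of them.
   This constant is itself taken as m. *)
exists (fun n _ => ((n * n) ^ n * (n * n))%N).
move=> N S grpG connG _ n k0 P rep _ irr Q Qip k W rkW.
have n_gt0 : (0 < n)%N by case: irr.
pose L := ((n * n) ^ n)%N; pose m := (L * (n * n))%N.
have nn_gt0 : (0 < n * n)%N by rewrite muln_gt0 n_gt0.
have L_gt0 : (0 < L)%N by rewrite expn_gt0 nn_gt0.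
exists m; split; first by rewrite leqnn andbT muln_gt0 L_gt0.
pose B := W^T; pose M := rhoR k0 P.
have rkB : \rank B = k by rewrite mxrank_tr.
have hne : exists h, HR S h by exists 1%:M; apply: HR1.
have hmul g h : HR S g -> HR S h -> exists2 h', HR S h' & M h' = M g *m M h.
  move=> Hg Hh; exists (g *m h); first exact: HR_mul.
  exact: rhoR_mul rep _ _ Hg Hh.
have hinv g : HR S g -> exists2 g', HR S g' & M g *m M g' = 1%:M.
  move=> Hg; have Hg' := HR_inv grpG Hg; exists (invmx g) => //.
  rewrite /M -(rhoR_mul rep Hg Hg') mulmxV ?(rhoR1 rep) //.
  by case: Hg.
have hirr := dual_irreducible irr.
have hgen U1 U2 h1 h2 : HR S h1 -> HR S h2 -> exists h, [/\ HR S h,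
    (rk M B h1 U1 <= rk M B h U1)%N & (rk M B h2 U2 <= rk M B h U2)%N].
  exact: rk_common.
pose v (r : nat) (t : 'M[RR]_N) := monov r (nummx P t).
have base (r : 'I_n.+1) : exists p : {R : nat & 'I_R -> 'M[RR]_N},
    [/\ (tag p <= L)%N, forall i, HR S (tagged p i), row_free (vmx (v r) (tagged p))
      & forall h, HR S h -> (v r h <= vmx (v r) (tagged p))%MS].
  have [R [y [leR Hy yfree yspan]]] := basis_points (HR S) (v r).
  exists (Tagged (fun R => 'I_R -> 'M[RR]_N) y); split=> //=.
  apply: leq_trans leR _; rewrite card_idx leq_pexp2l //.
  by rewrite -ltnS.
have [p pP] := fin_all_exists base.
(* One condition for each rank r and each choice [J] of positions in the tuple. A map [J] that is
   not injective gets the constant 1, so that it imposes nothing. *)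
pose I := {r : 'I_n.+1 & {ffun 'I_(tag (p r)) -> 'I_m}}.
pose phi (i : I) (h : 'I_m -> 'M[RR]_N) : RR :=
  if injectiveb (tagged i) then sepdet (v (tag i)) (tagged (p (tag i))) (h \o tagged i)
  else 1.
have reg i : regular (phi i).
  rewrite /phi; case: (injectiveb _); last exact: regular_const.
  exact: regular_sepdet.
have nz i : exists2 h, forall j, HR S (h j) & phi i h != 0.
  case: i => r J; have [_ Hy yfree _] := pP r.
  (* The base points are put at the positions chosen by [J], where the determinant is 1; the
     remaining positions are filled with the identity. *)
  exists (fun j => if [pick a | J a == j] is Some a then tagged (p r) a else 1%:M).
    by move=> j; case: pickP => [a _|_]; [apply: Hy|apply: HR1].
  rewrite /phi /=; case: injectiveP => [Jinj|_]; last exact: oner_neq0.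
  rewrite (@sepdet_ext _ _ _ _ _ _ _ (tagged (p r))); last first.
    move=> a /=; case: pickP => [b /eqP/Jinj->//|/(_ a)].
    by rewrite eqxx.
  by rewrite sepdet_base // oner_neq0.
have irrH := HR_irreducible grpG connG.
pose Phi h := \prod_i phi i h.
have regPhi : regular Phi := regular_prod reg.
have [hP HhP PhiP] := Hm_common_all irrH hne reg nz.
exists (fun h => in_Hm S h /\ Phi h != 0); split.
  split.
    have [q Hq] := regPhi; exists (eq q) => h; split=> [] [Hh Ph]; split=> //.
      by move=> /(_ q erefl); rewrite -Hq; apply/eqP.
    by apply/eqP => Ph0; apply: Ph => _ <-; rewrite -Hq.
  move=> T' van h Hh q Tq; apply/eqP/negPn/negP => qh.
  have regq : regular (fun h : 'I_m -> 'M[RR]_N => q.@[coordsRm h]) by exists q.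
  have [z [Hz Pz qz]] := Hm_common irrH regPhi regq HhP Hh PhiP qh.
  by move/eqP: qz; apply; apply: (van z).
move=> h [Hh /prodf_neq0 Ph] W'.
pose U := W' *m Q.
have rkU : \rank U = \rank W'.
  by rewrite /U mxrankMfree // row_free_unit posdef_unit //; case: Qip.
have dimE j : dim_proj Q (act M (h j) W) W' = rk M B (h j) U.
  by rewrite (dim_projE _ _ Qip) /act trmx_mul trmxK /rk mulmxA.
under eq_bigr => j _ do rewrite dimE.
rewrite mulrAC ler_pdivrMr ?ltr0n // -!natrM ler_nat -rkU -rkB.
have tight_or := @gr_lower_bound RR n _ (HR S) M B n_gt0 hne hmul hinv hirr hgen U.
move: tight_or; rewrite leq_eqVlt => /predU1P[tU|lt_gr].
  under eq_bigr => j _ do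
    rewrite (@tight_rk RR n _ (HR S) M B n_gt0 hne hmul hinv hirr hgen U _ tU (Hh j)).
  by rewrite sum_nat_const card_ord -mulnA tU; lia.
set s := gr M B hne U in lt_gr.
have le_sn : (s <= n)%N by apply: gr_leq_n.
have [x Hx xs] := gr_att M B hne U.
have few : (#|[pred j | (rk M B (h j) U < s)%N]| <= L)%N.
  pose r0 : 'I_n.+1 := Ordinal (le_sn : (s < n.+1)%N).
  have [leL Hy yfree yspan] := pP r0.
  apply: leq_trans leL; apply: ltnW.
  rewrite (eq_card (B := [pred j | (\rank (U *m nummx P (h j) *m B) < s)%N])).
    apply: (few_low_rank yspan yfree Hh _ Hx).
      move=> J Jinj; have := Ph (Tagged (fun r => {ffun 'I_(tag (p r)) -> 'I_m})
        (J : {ffun 'I_(tag (p r0)) -> 'I_m})) isT.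
      by rewrite /phi /= Jinj.
    by rewrite -(rk_nummx k0 P B U Hx) xs.
  by move=> j; rewrite !inE (rk_nummx k0 P B U (Hh j)).
have le_sum := sum_low_rank few; rewrite -/s in le_sum.
(* With d the rank of [U], n times the sum is at least m n s - L n s. Here n s is at least k d + 1
   and L n s is at most m, which leaves m k d. *)
have le_L : (L * (n * s) <= m)%N by rewrite /m leq_mul2l leq_mul2l le_sn !orbT.
have : (m * (\rank B * \rank U).+1 <= m * (n * s))%N by rewrite leq_mul2l lt_gr orbT.
have := leq_mul (leqnn n) le_sum.
rewrite mulnS !mulnDr; lia.
Qed.
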